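(* For every Riemannian manifolds $M$ and $N$ such that $M$ contains a minimal closed geodesic, the Riemannian product $M\times N$ has fractional index $$\beta_{M\times N}=0 .$$
   Context: All Riemannian manifolds are $C^\infty$, connected, countable at infinity and without boundary, and are endowed with their geodesic distance; $d_M$ and $\langle\cdot,\cdot\rangle_M$ denote the geodesic distance and the Riemannian metric of $M$. The Riemannian product $M\times N$ is the product manifold endowed with the metric $\langle u,v\rangle_{M\times N}=\langle u_M,v_M\rangle_M+\langle u_N,v_N\rangle_N$ for $u=(u_M,u_N)$, $v=(v_M,v_N)$ in $T_{(p,q)}(M\times N)=T_pM\times T_qN$. Its geodesic distance is $d_{M\times N}((p_1,q_1),(p_2,q_2))=\sqrt{d_M(p_1,p_2)^2+d_N(q_1,q_2)^2}$. A minimal closed geodesic in $M$ is a closed curve $\gamma$ with values in $M$ such that for every two points $P,Q$ on $\gamma$ there exists a minimal geodesic joining $P$ to $Q$ that is included in $\gamma$; in this case the restriction of $d_M$ to $\gamma$ equals the geodesic distance of $\gamma$, and $\gamma$ is isometric to a circle of length $L(\gamma)$, the length of $\gamma$. A symmetric function $f:S\times S\to\mathbb{R}$ on a set $S$ is a negative definite kernel if for every $n$, every $x_1,\dots,x_n\in S$ and every $c_1,\dots,c_n\in\mathbb{R}$ with $\sum_{i=1}^n c_i=0$, one has $\sum_{i,j=1}^n c_ic_jf(x_i,x_j)\le 0$. The fractional index of a metric space $(E,d)$ is the number $\beta_E\in[0,+\infty]$ (known to exist) such that for every $H>0$, the function $d^{2H}$ is a negative definite kernel if and only if $2H\le\b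eta_E$.
   Formalization: N is assumed to have positive dimension (for N a point and M a circle the product is the circle, of index 1, so the claim fails), and the closed curve of a minimal closed geodesic is taken to be simple and piecewise C^1. *)

(* Defs.v *)
From HB Require Import structures.
From mathcomp Require Import all_boot all_order all_algebra.
From mathcomp Require Import all_classical all_reals all_analysis.

Set Implicit Arguments.
Unset Strict Implicit.
Unset Printing Implicit Defensive.

Import Order.TTheory GRing.Theory Num.Theory.
Import numFieldNormedType.Exports.

Local Open Scope classical_set_scope.
Local Open Scope ring_scope.

Section Smooth.
Context {R : realType}.
Implicit Types V W : normedModType R.

(* Only meaningful for [U] open: differentials are taken in the whole space. *)
Fixpoint class_C (k : nat) V W (U : set V) (f : V -> W) : Prop :=
  if k is k'.+1 then
    (forall x, U x -> differentiable f x) /\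
    (forall v, class_C k' U (fun x => 'd f x v))
  else forall x, U x -> {for x, continuous f}.

Definition smooth_on V W (U : set V) (f : V -> W) := forall k, class_C k U f.

Lemma diff_eq_on V W (U : set V) (f g : V -> W) x :
  open U -> U x -> (forall y, U y -> f y = g y) -> differentiable f x ->
  differentiable g x /\ ('d g x = 'd f x :> (V -> W)).
Proof.
move=> oU Ux fg dfx.
have H : g \o shift x = cst (g x) + 'd f x +o_ 0 id.
  apply/eqaddoP => e e0.
  have /eqaddoP/(_ e e0) := diff_locally dfx.
  apply: filter_app.
  have : \forall y \near (0 : V), U (y + x).
    have : \forall y \near x, U y by exact: open_nbhs_nbhs.
    by rewrite (near_shift 0) /=; apply: filterS => y; rewrite /= subr0.
  apply: filterS => y Uy.
  by rewrite !fctE /= -(fg _ Uy) -(fg _ Ux).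
have dE : 'd g x = 'd f x :> (V -> W).
  by apply: diff_unique => //; exact: diff_continuous.
split=> //; apply/diff_locallyP; rewrite dE; split => //.
exact: diff_continuous.
Qed.

Lemma class_C_eq k V W (U : set V) (f g : V -> W) :
  open U -> (forall y, U y -> f y = g y) -> class_C k U f -> class_C k U g.
Proof.
move=> oU; elim: k f g => [|k ih] f g fg /=.
  move=> cf x Ux.
  have nU : nbhs x U by exact: open_nbhs_nbhs.
  have cfx : f @ x --> g x by rewrite -(fg _ Ux); exact: cf.
  apply: cvg_trans cfx; apply: near_eq_cvg.
  by apply: filterS nU => y /fg.
move=> [df cf]; split=> [x Ux|v].
  by have [] := diff_eq_on oU Ux fg (df _ Ux).
apply: ih (cf v) => y Uy.
by have [_ ->] := diff_eq_on oU Uy fg (df _ Uy).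
Qed.

Lemma class_C_linl k V W W' (U : set V) (f : V -> W) (L : {linear W -> W'}) :
  open U -> continuous L -> class_C k U f -> class_C k U (L \o f).
Proof.
move=> oU cL; elim: k f => [|k ih] f /=.
  by move=> cf x Ux; apply: continuous_comp; [exact: cf|exact: cL].
move=> [df cf]; split=> [x Ux|v].
  by apply: differentiable_comp; [exact: df|exact: linear_differentiable].
apply: class_C_eq (ih _ (cf v)) => // y Uy.
rewrite diff_comp//=; [|exact: df|exact: linear_differentiable].
by rewrite diff_lin.
Qed.

Lemma class_C_linr k V W V' (U : set V) (f : V -> W) (L : {linear V' -> V}) :
  open U -> continuous L -> class_C k U f -> class_C k (L @^-1` U) (f \o L).
Proof.
move=> oU cL; elim: k f => [|k ih] f /=.
  by move=> cf x Ux; apply: continuous_comp; [exact: cL|exact: cf].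
move=> [df cf]; split=> [x Ux|v].
  by apply: differentiable_comp; [exact: linear_differentiable|exact: df].
apply: class_C_eq (ih _ (cf (L v))) => [|y Uy].
  by apply: open_comp => // z _; exact: cL.
rewrite diff_comp//=; [|exact: linear_differentiable|exact: df].
by rewrite diff_lin.
Qed.

Lemma class_C_pair k V W W' (U : set V) (f : V -> W) (g : V -> W') :
  open U -> class_C k U f -> class_C k U g -> class_C k U (fun x => (f x, g x)).
Proof.
move=> oU; elim: k f g => [|k ih] f g /=.
  by move=> cf cg x Ux; apply: cvg_pair; [exact: cf|exact: cg].
move=> [df cf] [dg cg]; split=> [x Ux|v].
  by apply: differentiable_pair; [exact: df|exact: dg].
apply: class_C_eq (ih _ _ (cf v) (cg v)) => // y Uy.
by rewrite diff_pair//; [exact: df|exact: dg].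
Qed.

Lemma class_CS k V W (U U' : set V) (f : V -> W) :
  U `<=` U' -> class_C k U' f -> class_C k U f.
Proof.
move=> UU'; elim: k f => [|k ih] f /=; first by move=> cf x /UU'; exact: cf.
by move=> [df cf]; split=> [x /UU'|v]; [exact: df|exact: ih].
Qed.

Lemma class_CD k V W (U : set V) (f g : V -> W) :
  open U -> class_C k U f -> class_C k U g -> class_C k U (fun x => f x + g x).
Proof.
move=> oU; elim: k f g => [|k ih] f g /=.
  by move=> cf cg x Ux; apply: cvgD; [exact: cf|exact: cg].
move=> [df cf] [dg cg]; split=> [x Ux|v].
  by apply: (@differentiableD _ _ _ f g); [exact: df|exact: dg].
apply: class_C_eq (ih _ _ (cf v) (cg v)) => // y Uy.
by rewrite (@diffD _ _ _ f g)//; [exact: df|exact: dg].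
Qed.

End Smooth.

Section Products.
Context {R : realType}.

Definition row_mx_pair m n (p : 'rV[R]_m * 'rV[R]_n) : 'rV[R]_(m + n) :=
  row_mx p.1 p.2.

Lemma row_mx_pair_is_linear m n : linear (@row_mx_pair m n).
Proof.
by move=> a [u v] [u' v']; rewrite /row_mx_pair /= scale_row_mx add_row_mx.
Qed.

HB.instance Definition _ m n :=
  GRing.isLinear.Build R ('rV[R]_m * 'rV[R]_n)%type 'rV[R]_(m + n) _
    (@row_mx_pair m n) (@row_mx_pair_is_linear m n).

Lemma continuous_row_mx_pair m n : continuous (@row_mx_pair m n).
Proof.
move=> [u v] A /nbhs_ballP[e /= e0 eA].
apply/nbhs_ballP; exists e => //= -[u' v'] [/= [_ uu'] [_ vv']].
apply: eA; split=> // i j; rewrite /row_mx_pair /= !mxE.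
by case: (fintype.split j) => k; [exact: uu'|exact: vv'].
Qed.

Lemma hausdorff_prod (X Y : topologicalType) :
  hausdorff_space X -> hausdorff_space Y -> hausdorff_space (X * Y)%type.
Proof.
move=> hX hY [x y] [x' y'] xy; congr (_, _).
- apply: hX => A B Ax Bx'.
  have [] := xy (fst @^-1` A) (fst @^-1` B).
  + by apply: (cvg_fst Ax).
  + by apply: (cvg_fst Bx').
  by move=> [z ?] [/= Az Bz]; exists z.
- apply: hY => A B Ay By'.
  have [] := xy (snd @^-1` A) (snd @^-1` B).
  + by apply: (cvg_snd Ay).
  + by apply: (cvg_snd By').
  by move=> [? z] [/= Az Bz]; exists z.
Qed.

Lemma connected_prod (X Y : topologicalType) :
  connected [set: X] -> connected [set: Y] -> connected [set: (X * Y)%type].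
Proof.
move=> cX cY.
have [[[x0 y0]]|XY0] := pselect (inhabited (X * Y)); last first.
  have -> : [set: (X * Y)%type] = set0.
    by apply/seteqP; split => // p _; exfalso; apply: XY0; exists.
  exact: connected0.
pose A y := [set (x, y) | x in [set: X]] `|` [set (x0, y') | y' in [set: Y]].
have -> : [set: (X * Y)%type] = \bigcup_(y in [set: Y]) A y.
  by apply/seteqP; split=> // -[x y] _; exists y => //; left; exists x.
apply: bigcup_connected => [|y _].
  by exists (x0, y0) => y _; right; exists y0.
apply: connectedU.
- by exists (x0, y); split; [exists x0|exists y].
- apply: connected_continuous_connected => //; apply: continuous_subspaceT => x.
  by apply: cvg_pair; [exact: cvg_id|exact: cvg_cst].
- apply: connected_continuous_connected => //; apply: continuous_subspaceT => z.
  by apply: cvg_pair; [exact: cvg_cst|exact: cvg_id].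
Qed.

Definition countable_at_infinity (T : topologicalType) :=
  exists K : nat -> set T, (forall k, compact (K k)) /\ \bigcup_k K k = setT.

Lemma countable_at_infinity_prod (X Y : topologicalType) :
  countable_at_infinity X -> countable_at_infinity Y ->
  countable_at_infinity (X * Y)%type.
Proof.
move=> [K [cK KT]] [L [cL LT]].
exists (fun k => if unpickle k is Some ij then K ij.1 `*` L ij.2 else set0).
split=> [k|].
  by case: unpickle => [[i j]|] /=; [exact: compact_setX|exact: compact0].
apply/seteqP; split=> // -[x y] _.
have [i _ Kx] : (\bigcup_k K k) x by rewrite KT.
have [j _ Ly] : (\bigcup_k L k) y by rewrite LT.
by exists (pickle (i, j)) => //; rewrite pickleK.
Qed.

End Products.

Record chart (R : realType) (T : topologicalType) (n : nat) := Chart {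
  chart_dom : set T;
  chart_cod : set 'rV[R]_n;
  chart_map :> T -> 'rV[R]_n;
  chart_inv : 'rV[R]_n -> T;
  chart_dom_open : open chart_dom;
  chart_cod_open : open chart_cod;
  chart_mapP : forall p, chart_dom p -> chart_cod (chart_map p);
  chart_invP : forall x, chart_cod x -> chart_dom (chart_inv x);
  chart_mapK : forall p, chart_dom p -> chart_inv (chart_map p) = p;
  chart_invK : forall x, chart_cod x -> chart_map (chart_inv x) = x;
  chart_map_continuous : forall p, chart_dom p -> {for p, continuous chart_map};
  chart_inv_continuous : forall x, chart_cod x -> {for x, continuous chart_inv}
}.

Definition transition_dom (R : realType) (T : topologicalType) (n : nat)
    (phi psi : chart R T n) : set 'rV[R]_n :=
  chart_cod phi `&` chart_inv phi @^-1` chart_dom psi.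

Definition transition (R : realType) (T : topologicalType) (n : nat)
    (phi psi : chart R T n) : 'rV[R]_n -> 'rV[R]_n :=
  psi \o chart_inv phi.

(* [chart_at] selects a chart around every point; the geometric notions below
   do not depend on this selection. *)
Record manifold (R : realType) (n : nat) := Manifold {
  carrier :> topologicalType;
  chart_index : Type;
  charts : chart_index -> chart R carrier n;
  chart_at : carrier -> chart_index;
  chart_atP : forall p, chart_dom (charts (chart_at p)) p;
  transition_smooth : forall i j,
    smooth_on (transition_dom (charts i) (charts j))
              (transition (charts i) (charts j));
  manifold_nonempty : [set: carrier] !=set0;
  manifold_connected : connected [set: carrier];
  manifold_hausdorff : hausdorff_space carrier;
  manifold_countable : countable_at_infinity carrier
}.

(* The tangent vector [u] at the point of coordinates [x] in the chart [i] is
   the vector ['d (transition i j) x u] in the chart [j]; [metric_tensor i x u v] is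
   the Riemannian metric on the vectors of coordinates [u], [v] there. *)
Record riemannian_manifold (R : realType) (n : nat) := RiemannianManifold {
  manifold_of :> manifold R n;
  metric_tensor : chart_index manifold_of ->
    'rV[R]_n -> 'rV[R]_n -> 'rV[R]_n -> R;
  metric_linear : forall i x, chart_cod (charts i) x ->
    forall a u v w, metric_tensor i x (a *: u + v) w = a * metric_tensor i x u w + metric_tensor i x v w;
  metric_sym : forall i x, chart_cod (charts i) x ->
    forall u v, metric_tensor i x u v = metric_tensor i x v u;
  metric_pos : forall i x, chart_cod (charts i) x ->
    forall u, u != 0 -> 0 < metric_tensor i x u u;
  metric_smooth : forall i u v,
    smooth_on (chart_cod (charts i)) (fun x => metric_tensor i x u v);
  metric_compat : forall i j x, transition_dom (charts i) (charts j) x ->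
    let tau := transition (charts i) (charts j) in
    forall u v, metric_tensor i x u v = metric_tensor j (tau x) ('d tau x u) ('d tau x v)
}.

Section RiemannianProduct.
Context {R : realType}.

Section ChartProduct.
Context {X Y : topologicalType} {m n : nat}.
Variables (phi : chart R X m) (psi : chart R Y n).

Let dom := chart_dom phi `*` chart_dom psi.
Let cod : set 'rV[R]_(m + n) :=
  [set z | chart_cod phi (lsubmx z) /\ chart_cod psi (rsubmx z)].
Let map (p : X * Y) : 'rV[R]_(m + n) := row_mx (phi p.1) (psi p.2).
Let inv (z : 'rV[R]_(m + n)) := (chart_inv phi (lsubmx z), chart_inv psi (rsubmx z)).

Fact prod_dom_open : open dom.
Proof.
apply: openI; apply: open_comp; try exact: chart_dom_open.
- by move=> p _; exact: cvg_fst.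
- by move=> p _; exact: cvg_snd.
Qed.

Fact prod_cod_open : open cod.
Proof.
apply: openI; apply: open_comp; try exact: chart_cod_open.
- by move=> z _; exact: continuous_lsubmx.
- by move=> z _; exact: continuous_rsubmx.
Qed.

Fact prod_mapP p : dom p -> cod (map p).
Proof.
by move=> [? ?]; rewrite /cod /map /= row_mxKl row_mxKr; split; exact: chart_mapP.
Qed.

Fact prod_invP z : cod z -> dom (inv z).
Proof. by move=> [? ?]; split; exact: chart_invP. Qed.

Fact prod_mapK p : dom p -> inv (map p) = p.
Proof.
by move: p => [p q] [/= ? ?]; rewrite /inv /map /= row_mxKl row_mxKr !chart_mapK.
Qed.

Fact prod_invK z : cod z -> map (inv z) = z.
Proof. by move=> [? ?]; rewrite /inv /map /= !chart_invK// hsubmxK. Qed.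

Fact prod_map_continuous p : dom p -> {for p, continuous map}.
Proof.
move: p => [p q] [/= dp dq].
have cpq : (fun r : X * Y => (phi r.1, psi r.2)) @ (p, q) --> (phi p, psi q).
  have c1 : (phi \o fst) @ nbhs (p, q) --> phi p.
    by apply: (cvg_comp _ _ cvg_fst); exact: (chart_map_continuous dp).
  have c2 : (psi \o snd) @ nbhs (p, q) --> psi q.
    by apply: (cvg_comp _ _ cvg_snd); exact: (chart_map_continuous dq).
  exact: (cvg_pair c1 c2).
exact: (cvg_comp _ _ cpq (@continuous_row_mx_pair R m n _)).
Qed.

Fact prod_inv_continuous z : cod z -> {for z, continuous inv}.
Proof.
move=> [cl cr].
have c1 : (chart_inv phi \o lsubmx) @ z --> chart_inv phi (lsubmx z).
  apply: (cvg_comp _ _ (@continuous_lsubmx _ _ _ _ z)).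
  exact: chart_inv_continuous.
have c2 : (chart_inv psi \o rsubmx) @ z --> chart_inv psi (rsubmx z).
  apply: (cvg_comp _ _ (@continuous_rsubmx _ _ _ _ z)).
  exact: chart_inv_continuous.
exact: (cvg_pair c1 c2).
Qed.

Definition chart_prod : chart R (X * Y)%type (m + n) :=
  Chart prod_dom_open prod_cod_open prod_mapP prod_invP prod_mapK prod_invK
    prod_map_continuous prod_inv_continuous.

End ChartProduct.

Lemma transition_dom_open (T : topologicalType) n (phi psi : chart R T n) :
  open (transition_dom phi psi).
Proof.
rewrite openE => x [cx dx]; apply: filterI.
  by apply: open_nbhs_nbhs; split=> //; exact: chart_cod_open.
apply: (chart_inv_continuous cx).
by apply: open_nbhs_nbhs; split=> //; exact: chart_dom_open.
Qed.

Lemma transition_prod (X Y : topologicalType) m n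
    (phi phi' : chart R X m) (psi psi' : chart R Y n) :
  transition (chart_prod phi psi) (chart_prod phi' psi') =
  @row_mx_pair R m n \o
    (fun z => (transition phi phi' (lsubmx z), transition psi psi' (rsubmx z))).
Proof. by []. Qed.

Section ManifoldProduct.
Context {m n : nat}.
Variables (M : manifold R m) (N : manifold R n).

Let I := (chart_index M * chart_index N)%type.
Let ch (ij : I) := chart_prod (charts ij.1) (charts ij.2).
Let at_ (p : M * N) : I := (chart_at p.1, chart_at p.2).

Fact prod_chart_atP p : chart_dom (ch (at_ p)) p.
Proof. by split; exact: chart_atP. Qed.

Fact prod_transition_smooth i j :
  smooth_on (transition_dom (ch i) (ch j)) (transition (ch i) (ch j)).
Proof.
move=> k; rewrite transition_prod; apply: class_C_linl.
- exact: transition_dom_open.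
- exact: continuous_row_mx_pair.
apply: class_C_pair; first exact: transition_dom_open.
- apply: class_CS; last first.
    apply: (@class_C_linr _ _ _ _ _ _ _ (@lsubmx R 1 m n)).
    + exact: (@transition_dom_open _ _ (charts i.1) (charts j.1)).
    + exact: continuous_lsubmx.
    + exact: transition_smooth.
  by move=> z [[c1 c2] [d1 d2]].
- apply: class_CS; last first.
    apply: (@class_C_linr _ _ _ _ _ _ _ (@rsubmx R 1 m n)).
    + exact: (@transition_dom_open _ _ (charts i.2) (charts j.2)).
    + exact: continuous_rsubmx.
    + exact: transition_smooth.
  by move=> z [[c1 c2] [d1 d2]].
Qed.

Fact prod_nonempty : [set: (M * N)%type] !=set0.
Proof.
have [p _] := @manifold_nonempty _ _ M; have [q _] := @manifold_nonempty _ _ N.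
by exists (p, q).
Qed.

Definition manifold_prod : manifold R (m + n) :=
  Manifold prod_chart_atP prod_transition_smooth prod_nonempty
    (connected_prod (@manifold_connected _ _ M) (@manifold_connected _ _ N))
    (hausdorff_prod (@manifold_hausdorff _ _ M) (@manifold_hausdorff _ _ N))
    (countable_at_infinity_prod (@manifold_countable _ _ M)
      (@manifold_countable _ _ N)).

End ManifoldProduct.

Section MetricProduct.
Context {m n : nat}.
Variables (M : riemannian_manifold R m) (N : riemannian_manifold R n).

Let P := manifold_prod M N.

Definition metric_prod (ij : chart_index P) (z u v : 'rV[R]_(m + n)) : R :=
  metric_tensor ij.1 (lsubmx z) (lsubmx u) (lsubmx v) +
  metric_tensor ij.2 (rsubmx z) (rsubmx u) (rsubmx v).

Fact metric_prod_linear i x : chart_cod (@charts _ _ P i) x ->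
  forall a u v w,
  metric_prod i x (a *: u + v) w = a * metric_prod i x u w + metric_prod i x v w.
Proof.
move=> [cl cr] a u v w; rewrite /metric_prod !linearP /= !metric_linear//.
by rewrite mulrDr addrACA.
Qed.

Fact metric_prod_sym i x : chart_cod (@charts _ _ P i) x ->
  forall u v, metric_prod i x u v = metric_prod i x v u.
Proof.
by move=> [cl cr] u v; rewrite /metric_prod metric_sym// [X in _ + X]metric_sym.
Qed.

Lemma metric_ge0 k (Q : riemannian_manifold R k) (i : chart_index Q) x :
  chart_cod (charts i) x -> forall u, 0 <= metric_tensor i x u u.
Proof.
move=> cx u; have [->|u0] := eqVneq u 0; last exact/ltW/metric_pos.
have := metric_linear cx (-1) 0 0 0.
by rewrite scaler0 addr0 mulN1r addNr => ->.
Qed.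

Fact metric_prod_pos i x : chart_cod (@charts _ _ P i) x ->
  forall u, u != 0 -> 0 < metric_prod i x u u.
Proof.
move=> [cl cr] u u0; rewrite /metric_prod.
have [l0|l0] := eqVneq (lsubmx u) 0.
  rewrite ltr_wpDl ?metric_ge0// metric_pos//.
  by apply: contra_neq u0 => r0; rewrite -[u]hsubmxK l0 r0 row_mx0.
by rewrite ltr_wpDr ?metric_ge0// metric_pos.
Qed.

Fact metric_prod_smooth i u v :
  smooth_on (chart_cod (@charts _ _ P i)) (fun x => metric_prod i x u v).
Proof.
move=> k; apply: class_CD; first exact: chart_cod_open.
- apply: class_CS; last first.
    apply: (@class_C_linr _ _ _ _ _ (chart_cod (charts i.1))
              (fun x => metric_tensor i.1 x (lsubmx u) (lsubmx v))
              (@lsubmx R 1 m n)).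
    + exact: chart_cod_open.
    + exact: continuous_lsubmx.
    + exact: metric_smooth.
  by move=> z [].
- apply: class_CS; last first.
    apply: (@class_C_linr _ _ _ _ _ (chart_cod (charts i.2))
              (fun x => metric_tensor i.2 x (rsubmx u) (rsubmx v))
              (@rsubmx R 1 m n)).
    + exact: chart_cod_open.
    + exact: continuous_rsubmx.
    + exact: metric_smooth.
  by move=> z [].
Qed.

Fact metric_prod_compat i j x :
  transition_dom (@charts _ _ P i) (@charts _ _ P j) x ->
  let tau := transition (@charts _ _ P i) (@charts _ _ P j) in
  forall u v,
  metric_prod i x u v = metric_prod j (tau x) ('d tau x u) ('d tau x v).
Proof.
move=> [[c1 c2] [d1 d2]] tau u v.
set t1 := transition (charts i.1) (charts j.1).
set t2 := transition (charts i.2) (charts j.2).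
have D1 : differentiable t1 (lsubmx x).
  by have [+ _] := transition_smooth (m := M) i.1 j.1 1; apply.
have D2 : differentiable t2 (rsubmx x).
  by have [+ _] := transition_smooth (m := N) i.2 j.2 1; apply.
have dl := @differentiable_lsubmx R 1 m n x.
have dr := @differentiable_rsubmx R 1 m n x.
have dE w : 'd tau x w =
    row_mx ('d t1 (lsubmx x) (lsubmx w)) ('d t2 (rsubmx x) (rsubmx w)).
  rewrite /tau transition_prod.
  have D1l : differentiable (t1 \o lsubmx) x by exact: differentiable_comp.
  have D2r : differentiable (t2 \o rsubmx) x by exact: differentiable_comp.
  have cr := @continuous_row_mx_pair R m n.
  rewrite diff_comp; first last.
  - exact: linear_differentiable.
  - exact: (differentiable_pair D1l D2r).
  rewrite /= (diff_lin _ cr) (diff_pair D1l D2r) /=.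
  rewrite (diff_comp dl D1) (diff_comp dr D2) /=.
  by rewrite !diff_lin//; [exact: continuous_rsubmx|exact: continuous_lsubmx].
rewrite /metric_prod !dE !row_mxKl !row_mxKr.
rewrite (metric_compat (i := i.1) (j := j.1))//.
rewrite (metric_compat (i := i.2) (j := j.2))//.
Qed.

Definition riemannian_prod : riemannian_manifold R (m + n) :=
  RiemannianManifold metric_prod_linear metric_prod_sym metric_prod_pos
    metric_prod_smooth metric_prod_compat.

End MetricProduct.
End RiemannianProduct.

Section Geodesics.
Context {R : realType} {n : nat}.
Variable M : riemannian_manifold R n.
Implicit Types (gamma sigma : R -> M) (P Q : M).

Definition local_chart gamma (t : R) : chart_index M := chart_at (gamma t).

Definition local_curve gamma (t : R) : R -> 'rV[R]_n :=
  charts (local_chart gamma t) \o gamma.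

Definition C1_at gamma (t : R) :=
  [/\ {for t, continuous gamma},
      \forall s \near t, derivable (local_curve gamma t) s 1 &
      {for t, continuous ('D_1 (local_curve gamma t))}].

(* One-sided derivatives at the end points are avoided by asking for a C^1
   extension past them. *)
Definition C1_on gamma (a b : R) :=
  exists2 sigma, {in `[a, b], gamma =1 sigma} &
                 forall t, t \in `[a, b] -> C1_at sigma t.

Inductive piecewise_C1 gamma : R -> R -> Prop :=
| piecewise_C1_arc a b : a < b -> C1_on gamma a b -> piecewise_C1 gamma a b
| piecewise_C1_cat a b c :
    piecewise_C1 gamma a b -> piecewise_C1 gamma b c -> piecewise_C1 gamma a c.

Definition speed gamma (t : R) : R :=
  let x := local_curve gamma t in
  Num.sqrt (metric_tensor (local_chart gamma t) (x t) ('D_1 x t) ('D_1 x t)).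

Definition curve_length gamma (a b : R) : R :=
  \int[lebesgue_measure]_(t in `[a, b]) speed gamma t.

Definition geodesic_dist P Q : R :=
  inf [set l | exists gamma a b,
    [/\ piecewise_C1 gamma a b, gamma a = P, gamma b = Q &
        l = curve_length gamma a b]].

(* The geodesic equation in covariant form, i.e. the Euler-Lagrange equation of
   the energy: d/dt g_x(x', w) = 1/2 (D_w g)_x(x', x') for every constant w.
   Expanding the left-hand side and raising the index gives
   x''^k + Gamma^k_ij x'^i x'^j = 0. *)
Definition geodesic_at gamma (t : R) :=
  C1_at gamma t /\
  let i := local_chart gamma t in
  let x := local_curve gamma t in
  forall w : 'rV[R]_n,
    is_derive t 1 (fun s => metric_tensor i (x s) ('D_1 x s) w)
      (2^-1 * 'D_w (fun y => metric_tensor i y ('D_1 x t) ('D_1 x t)) (x t)).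

Definition minimal_geodesic sigma (a b : R) P Q :=
  [/\ a < b, forall t, t \in `[a, b] -> geodesic_at sigma t,
      sigma a = P, sigma b = Q &
      curve_length sigma a b = geodesic_dist P Q].

Definition minimal_closed_geodesic gamma (a b : R) :=
  [/\ piecewise_C1 gamma a b,
      gamma a = gamma b,
      {in `[a, b[ &, injective gamma} &
      forall P Q, (gamma @` `[a, b]) P -> (gamma @` `[a, b]) Q ->
        exists sigma c d, minimal_geodesic sigma c d P Q /\
                          sigma @` `[c, d] `<=` gamma @` `[a, b]].

End Geodesics.

Arguments geodesic_dist {R n} M P Q.
Arguments minimal_closed_geodesic {R n} M gamma a b.

Section FractionalIndex.
Context {R : realType}.

Definition negative_definite_kernel (S : Type) (f : S -> S -> R) :=
  (forall x y, f x y = f y x) /\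
  forall n (x : 'I_n -> S) (c : 'I_n -> R), \sum_i c i = 0 ->
    \sum_i \sum_j c i * c j * f (x i) (x j) <= 0.

Definition is_fractional_index (E : Type) (d : E -> E -> R) (beta : \bar R) :=
  (0 <= beta)%E /\
  forall H : R, 0 < H ->
    (negative_definite_kernel (fun x y => d x y `^ (2 * H)) <->
     ((2 * H)%:E <= beta)%E).

End FractionalIndex.

(* Main.v *)
Require Import Defs.
From mathcomp Require Import all_boot all_order all_algebra.
From mathcomp Require Import all_classical all_reals all_analysis.
From mathcomp Require Import measurable_realfun ring lra.

(** The product contains a cylinder, on which every power of the distance fails
    to be a negative definite kernel.

    A minimal closed geodesic of [M] consists of two metric segments of some
    length [a] > 0 joining two points [P] and [Q] ([closed_geodesic_antipodes]).
    Let [X] be the point at distance [h] from [P] on one of them, and [Y] the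
    point at distance [h] from [Q] on the other: then [d P Q = d X Y = a],
    [d P X = d Q Y = h] and [d P Y = d X Q = a - h].  Give the charge 1 to [P]
    and [Q] and the charge -1 to [X] and [Y], and repeat these four charges over
    points S_0, .., S_(m-1) of [N].  Since the distance of the product satisfies
    the Pythagorean formula ([product_dist]), the quadratic form of the kernel
    d^(2H) on these charges is 4 times the sum over k, l of
        (a^2 + r^2)^H - ((a - h)^2 + r^2)^H - ((h^2 + r^2)^H - (r^2)^H)
    where r is the distance between S_k and S_l.  The first difference has order
    h exactly, because the distance to a point of a circle has a corner at the
    antipode.  The second one is the interaction of a dipole (P, X) with its
    copies.  For a single copy it is h^(2H), which only suffices when 2H > 1; but
    for 2H <= 1 it decays with r, so that it becomes negligible on average when
    the dipole is spread over m copies with h of order 1/m and r at least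
    |k - l| h: it adds up to O(m^(1-H)), whereas the first differences add up to
    a multiple of m.  Hence the form takes positive values for every H > 0
    ([positive_total_energy]).

    Points of [N] with mutual distances at least |k - l| h are found on any curve
    between two distinct points by the intermediate value theorem applied to the
    distance to one of them ([separated_points]).

    What remains is the geometry behind these facts.  Near a point the geodesic
    distance agrees to first order with the norm given by the metric tensor in a
    chart.  It is at most that, because the straight segments of the chart are
    curves of almost that length ([dist_chart_upper]).  It is at least that,
    because the chart norm, truncated so as to extend to the whole manifold,
    varies along a curve no faster than the arc length ([dist_chart_lower], by
    [curve_length_lower_bound]).  The norm of the product metric is Pythagorean
    by definition, and this passes to the distances: from below because
    x d_M + y d_N, for x^2 + y^2 = 1, varies no faster than the arc length in the
    product; from above by following almost minimizing paths of both factors at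
    constant rates.  Passing from such infinitesimal estimates to global ones is
    always done by [dini_nonincreasing].

    On the closed geodesic, a minimal path between two points stays in the curve,
    so it must leave a closed arc through one of its ends
    ([closed_geodesic_separation]).  Taking for [Q] a point farthest from [P],
    a minimal path from a point of one of the two arcs to [P] cannot pass through
    [Q]; this makes both arcs metric segments. *)

Set Implicit Arguments.
Unset Strict Implicit.
Unset Printing Implicit Defensive.

Import Order.TTheory GRing.Theory Num.Theory.
Import numFieldNormedType.Exports.

Local Open Scope classical_set_scope.
Local Open Scope ring_scope.

(** * Functions controlled by their increments *)

Section Dini.
Context {R : realType}.

(** A function whose one-sided upper derivatives are nonpositive decreases: for each
    e, the points up to which it grows at rate at most e form a set that contains
    its supremum and cannot stop before [b].  Increments replace derivatives because
    distance functions need not be differentiable. *)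
Lemma dini_nonincreasing (F : R -> R) (a b : R) : a <= b ->
  (forall t, a <= t <= b -> forall e, 0 < e -> \forall s \near t, a <= s <= b ->
     (t <= s -> F s - F t <= e * (s - t)) /\
     (s <= t -> F t - F s <= e * (t - s))) ->
  F b <= F a.
Proof.
move=> ab dF.
suff main e : 0 < e -> F b - F a <= e * (b - a).
  apply/ler_addgt0Pr => e e0.
  have e1 : 0 < e / (b - a + 1) by apply: divr_gt0 => //; lra.
  have := main _ e1.
  have : e / (b - a + 1) * (b - a) <= e.
    by rewrite mulrAC ler_pdivrMr; [rewrite ler_pM2l//; lra|lra].
  lra.
move=> e0.
pose A := [set t | a <= t <= b /\ F t - F a <= e * (t - a)].
have Aa : A a by split; [rewrite lexx ab|rewrite !subrr mulr0].
have supA : has_sup A by split; [exists a|exists b => t [/andP[]]].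
pose c := sup A.
have ac : a <= c by apply: ub_le_sup => //; exact: (proj2 supA).
have cb : c <= b by apply: ge_sup; [exists a|move=> t [/andP[]]].
have /nbhs_ballP[d /= d0 dc] := dF c (introT andP (conj ac cb)) e e0.
have Ac : A c.
  have [s [/andP[as_ sb] Fs] cs] := sup_adherent d0 supA.
  have sc : s <= c by apply: ub_le_sup; [exact: (proj2 supA)|split=> //; rewrite as_ sb].
  have [|_ /(_ sc)] := dc s _ (introT andP (conj as_ sb)).
    rewrite /ball/= ger0_norm ?subr_ge0//; move: cs; rewrite -/c; lra.
  by split; [rewrite ac cb|lra].
have [<-|cbn] := eqVneq c b; first by case: Ac.
have {}cb : c < b by rewrite lt_neqAle cbn.
pose s := Num.min b (c + d / 2).
have cs : c < s by rewrite lt_min cb/= ltrDl divr_gt0.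
have sb : s <= b by rewrite ge_min lexx.
have [|/(_ (ltW cs)) Fs _] := dc s _ (introT andP (conj (le_trans ac (ltW cs)) sb)).
  rewrite /ball/= distrC ger0_norm ?subr_ge0 ?ltW//.
  have : s <= c + d / 2 by rewrite ge_min lexx orbT.
  lra.
have : A s.
  by case: Ac => _ Fc; split; [rewrite (le_trans ac (ltW cs)) sb|lra].
by move=> /(ub_le_sup (proj2 supA)); rewrite -/c leNgt cs.
Qed.

Lemma derivable_expansion (V : normedModType R) (f : R -> V) t :
  derivable f t 1 -> forall e, 0 < e -> \forall s \near t,
  `|f s - f t - (s - t) *: 'D_1 f t| <= e * `|s - t|.
Proof.
move=> df e e0; have dff := (derivable1_diffP f t).1 df.
have /eqaddoP/(_ e e0) := diff_locally dff.
rewrite -[X in X -> _]/(\forall x \near (0:R), _).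
rewrite [X in X -> _](near_shift t) /=; apply: filterS => s /=.
rewrite !fctE /= sub0r subrK opprD addrA.
have -> : 'D_1 f t = 'd f t 1 by exact: deriveE.
by rewrite -linearZ /= [_ *: _]mulr1.
Qed.

End Dini.

(** * The norm of tangent vectors in a chart *)

Lemma coord_le_norm {R : realType} m n (A : 'M[R]_(m, n)) i j :
  `|A i j| <= `|A|.
Proof.
rewrite [leRHS]/Num.norm /= mx_normrE.
by apply/bigmax_geP; right => /=; exists (i, j).
Qed.

Lemma cvg_sum_ord {R : realType} (T : Type) (F : set_system T) {FF : Filter F}
    n (f : 'I_n -> T -> R) (l : 'I_n -> R) :
  (forall k, f k @ F --> l k) -> (fun t => \sum_k f k t) @ F --> \sum_k l k.
Proof.
by move=> fl; apply: cvg_big => [|k _]; [exact: add_continuous|exact: fl].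
Qed.

Section ChartNorm.
Context {R : realType} {n : nat} (M : riemannian_manifold R n).
Implicit Types (i : chart_index M) (x u v : 'rV[R]_n).

Definition chart_norm i x u : R := Num.sqrt (metric_tensor i x u u).

Section Point.
Variables (i : chart_index M) (x : 'rV[R]_n).
Hypothesis cx : chart_cod (charts i) x.
Local Notation g := (metric_tensor i x).

Lemma metric0l v : g 0 v = 0.
Proof.
by have := metric_linear cx (-1) 0 0 v; rewrite scaler0 addr0 mulN1r addNr.
Qed.

Lemma metricDl u v w : g (u + v) w = g u w + g v w.
Proof. by rewrite -[u]scale1r metric_linear// mul1r scale1r. Qed.

Lemma metricZl a u v : g (a *: u) v = a * g u v.
Proof. by rewrite -[a *: u]addr0 metric_linear// metric0l addr0. Qed.

Lemma metricDr u v w : g u (v + w) = g u v + g u w.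
Proof. by rewrite Defs.metric_sym// metricDl !(Defs.metric_sym cx u). Qed.

Lemma metricZr a u v : g u (a *: v) = a * g u v.
Proof. by rewrite Defs.metric_sym// metricZl Defs.metric_sym. Qed.

Lemma metric_suml (I : Type) (r : seq I) (F : I -> 'rV[R]_n) v :
  g (\sum_(k <- r) F k) v = \sum_(k <- r) g (F k) v.
Proof.
elim: r => [|k r IH]; first by rewrite !big_nil metric0l.
by rewrite !big_cons metricDl IH.
Qed.

(** Reduces the joint continuity of the metric tensor to that of its finitely many
    coefficients, which is what smoothness provides. *)
Lemma metric_expansion u v : g u v =
  \sum_k \sum_l u 0 k * v 0 l * g (delta_mx 0 k) (delta_mx 0 l).
Proof.
rewrite {1}(row_sum_delta u) metric_suml; apply: eq_bigr => k _.
rewrite metricZl Defs.metric_sym// {1}(row_sum_delta v) metric_suml mulr_sumr.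
by apply: eq_bigr => l _; rewrite metricZl mulrA Defs.metric_sym.
Qed.

Lemma chart_norm_ge0 u : 0 <= chart_norm i x u.
Proof. exact: sqrtr_ge0. Qed.

Lemma chart_norm_sqr u : chart_norm i x u ^+ 2 = g u u.
Proof. by rewrite sqr_sqrtr// metric_ge0. Qed.

Lemma chart_normZ a u : chart_norm i x (a *: u) = `|a| * chart_norm i x u.
Proof.
by rewrite /chart_norm metricZl metricZr mulrA -expr2 sqrtrM ?sqr_ge0// sqrtr_sqr.
Qed.

Lemma chart_norm0_eq0 u : chart_norm i x u = 0 -> u = 0.
Proof.
move=> nu0; apply/eqP; apply: contraT => /(metric_pos cx).
by rewrite -chart_norm_sqr nu0 expr0n ltxx.
Qed.

Lemma metric_cauchy_schwarz u v : g u v <= chart_norm i x u * chart_norm i x v.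
Proof.
set a := chart_norm i x u; set b := chart_norm i x v.
have a0 : 0 <= a by exact: chart_norm_ge0.
have b0 : 0 <= b by exact: chart_norm_ge0.
have [a00|an0] := eqVneq a 0.
  by rewrite (chart_norm0_eq0 a00) metric0l a00 mul0r.
have [b00|bn0] := eqVneq b 0.
  by rewrite (chart_norm0_eq0 b00) Defs.metric_sym// metric0l b00 mulr0.
have := metric_ge0 cx (b *: u + (- a) *: v).
rewrite !(metricDl, metricDr, metricZl, metricZr) (Defs.metric_sym cx v u).
rewrite -!chart_norm_sqr -/a -/b.
have ab : 0 < a * b by rewrite mulr_gt0// lt_neqAle eq_sym ?an0 ?bn0.
move=> H; rewrite -(ler_pM2l ab); lra.
Qed.

Lemma chart_normD u v :
  chart_norm i x (u + v) <= chart_norm i x u + chart_norm i x v.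
Proof.
rewrite -(@ler_pXn2r _ 2) ?nnegrE ?addr_ge0 ?chart_norm_ge0//.
rewrite chart_norm_sqr metricDl !metricDr (Defs.metric_sym cx v u).
rewrite sqrrD !chart_norm_sqr.
have := metric_cauchy_schwarz u v; lra.
Qed.

Lemma chart_normN u : chart_norm i x (- u) = chart_norm i x u.
Proof. by rewrite -scaleN1r chart_normZ normrN1 mul1r. Qed.

Lemma chart_normB u v :
  `|chart_norm i x u - chart_norm i x v| <= chart_norm i x (u - v).
Proof.
rewrite ler_norml; apply/andP; split.
  by have := chart_normD (v - u) u; rewrite subrK -[v - u]opprB chart_normN; lra.
by have := chart_normD (u - v) v; rewrite subrK; lra.
Qed.

End Point.

Lemma metric_continuous i u v x : chart_cod (charts i) x ->
  {for x, continuous (fun y => metric_tensor i y u v)}.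
Proof. by move=> cx; have /(_ 0 x cx) := metric_smooth i u v. Qed.

Lemma metric_cvg (T : Type) (F : set_system T) {FF : Filter F}
    i x u (f h : T -> 'rV[R]_n) : chart_cod (charts i) x ->
  f @ F --> x -> h @ F --> u ->
  (fun t => metric_tensor i (f t) (h t) (h t)) @ F --> metric_tensor i x u u.
Proof.
move=> cx fx hu.
have fcod : \forall t \near F, chart_cod (charts i) (f t).
  by apply: fx; apply: open_nbhs_nbhs; split=> //; exact: chart_cod_open.
have -> : metric_tensor i x u u = \sum_k \sum_l u 0 k * u 0 l *
    metric_tensor i x (delta_mx 0 k) (delta_mx 0 l) by exact: metric_expansion.
have H : (fun t => \sum_k \sum_l h t 0 k * h t 0 l *
    metric_tensor i (f t) (delta_mx 0 k) (delta_mx 0 l)) @ F -->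
    \sum_k \sum_l u 0 k * u 0 l *
    metric_tensor i x (delta_mx 0 k) (delta_mx 0 l).
  apply: cvg_sum_ord => k; apply: cvg_sum_ord => l.
  have hk j : h t 0 j @[t --> F] --> u 0 j.
    by apply: (cvg_comp _ (fun w : 'rV[R]_n => w 0 j) hu); exact: coord_continuous.
  have gx : metric_tensor i (f t) (delta_mx 0 k) (delta_mx 0 l) @[t --> F] -->
      metric_tensor i x (delta_mx 0 k) (delta_mx 0 l).
    have := cvg_comp f (fun y => metric_tensor i y (delta_mx 0 k) (delta_mx 0 l)) fx.
    by apply; exact: metric_continuous.
  exact: (cvgM (cvgM (hk k) (hk l)) gx).
apply: cvg_trans H; apply: near_eq_cvg.
by apply: filterS fcod => t ct; rewrite metric_expansion.
Qed.

Lemma chart_norm_cvg (T : Type) (F : set_system T) {FF : Filter F}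
    i x u (f h : T -> 'rV[R]_n) : chart_cod (charts i) x ->
  f @ F --> x -> h @ F --> u ->
  (fun t => chart_norm i (f t) (h t)) @ F --> chart_norm i x u.
Proof.
move=> cx fx hu.
have := cvg_comp _ (@Num.sqrt R) (metric_cvg cx fx hu).
by apply; exact: sqrt_continuous.
Qed.

Lemma chart_norm_upper i x : chart_cod (charts i) x ->
  exists2 C : R, 0 < C & forall u, chart_norm i x u <= C * `|u|.
Proof.
move=> cx.
have c0 : chart_norm i x u @[u --> (0 : 'rV[R]_n)] --> chart_norm i x 0.
  exact: (chart_norm_cvg (FF := nbhs_filter (0 : 'rV[R]_n)) (f := cst x)
    (h := id) cx (cvg_cst _) cvg_id).
have nu0 : chart_norm i x 0 = 0.
  by rewrite -(scale0r (0 : 'rV[R]_n)) chart_normZ// normr0 mul0r.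
rewrite nu0 in c0.
have /nbhs_ballP[d /= d0 hd] := c0 _ (lt_nbhsl ltr01).
exists (2 / d); first by rewrite divr_gt0.
move=> u; have [->|u0] := eqVneq u 0; first by rewrite normr0 mulr0 nu0.
have un0 : 0 < `|u| by rewrite normr_gt0.
have du0 : 0 < d / 2 / `|u| by rewrite !divr_gt0.
have : chart_norm i x ((d / 2 / `|u|) *: u) < 1.
  apply: hd; rewrite -ball_normE /ball_ /= sub0r normrN normrZ gtr0_norm//.
  by rewrite mulfVK ?gt_eqF//; lra.
rewrite chart_normZ// gtr0_norm// -ltr_pdivlMl// mulr1 => /ltW /le_trans; apply.
by rewrite le_eqVlt; apply/orP; left; apply/eqP; field; rewrite !gt_eqF.
Qed.

(** By compactness of the unit sphere for the sup norm. *)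
Lemma chart_norm_lower i x : chart_cod (charts i) x ->
  exists2 c : R, 0 < c & forall u, c * `|u| <= chart_norm i x u.
Proof.
move=> cx.
pose S := [set u : 'rV[R]_n | `|u| = 1].
have [S0|/set0P S0] := eqVneq S set0.
  exists 1 => // u; have [->|u0] := eqVneq u 0.
    by rewrite normr0 mulr0 chart_norm_ge0.
  have : S (`|u|^-1 *: u).
    by rewrite /S/= normrZ normfV normr_id mulVf// normr_eq0.
  by rewrite S0.
have cS : compact S.
  apply: bounded_closed_compact.
    by exists 1; split => // y y1 u /= ->; exact: ltW.
  have -> : S = (fun u => `|u|) @^-1` [set 1] by [].
  by apply: closed_comp => [u _|]; [exact: norm_continuous|exact: closed_eq].
have [u0 Su0 mu0] : exists2 u0, u0 \in S &
    forall u, u \in S -> chart_norm i x u0 <= chart_norm i x u.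
  apply: EVT_min_rV => //; apply: continuous_subspaceT => u.
  by apply: (@chart_norm_cvg _ (nbhs u) _ i x u (cst x) id cx);
    [exact: cvg_cst|exact: cvg_id].
have u00 : u0 != 0.
  move: Su0; rewrite inE /S/= => Su0; apply: contra_eq_neq Su0 => ->.
  by rewrite normr0 eq_sym oner_eq0.
exists (chart_norm i x u0).
  rewrite lt_neqAle chart_norm_ge0 andbT eq_sym; apply: contra_neq u00.
  exact: chart_norm0_eq0.
move=> u; have [->|un0] := eqVneq u 0.
  by rewrite normr0 mulr0 chart_norm_ge0.
have nu0 : 0 < `|u| by rewrite normr_gt0.
have := mu0 (`|u|^-1 *: u); rewrite inE /S/=.
rewrite normrZ normfV normr_id mulVf ?gt_eqF// => /(_ erefl).
by rewrite chart_normZ// normfV normr_id mulrC ler_pdivlMr.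
Qed.

(** The coefficients of the metric tensor are continuous, and the form at [x] is
    bounded below on unit vectors, so a small absolute variation of the form is a
    small relative one, uniformly in the vector. *)
Lemma chart_norm_near i x (e : R) : chart_cod (charts i) x -> 0 < e ->
  \forall y \near x, chart_cod (charts i) y /\
    forall u, chart_norm i y u <= (1 + e) * chart_norm i x u /\
              chart_norm i x u <= (1 + e) * chart_norm i y u.
Proof.
move=> cx e0; have [c c0 hc] := chart_norm_lower cx.
pose D (y : 'rV[R]_n) : R := \sum_k \sum_l `|metric_tensor i y (delta_mx 0 k) (delta_mx 0 l) -
  metric_tensor i x (delta_mx 0 k) (delta_mx 0 l)|.
pose k := e / (1 + e) * c ^+ 2.
have k0 : 0 < k by rewrite mulr_gt0 ?exprn_gt0// divr_gt0//; lra.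
have Dx : D y @[y --> x] --> 0.
  have -> : 0 = \sum_(k < n) \sum_(l < n) (0 : R) by rewrite !big1.
  apply: (@cvg_sum_ord _ _ (nbhs x)) => p; apply: (@cvg_sum_ord _ _ (nbhs x)) => q.
  apply/norm_cvg0P/subr_cvg0 => /=.
  exact: metric_continuous.
have nD : \forall y \near x, D y < k.
  exact: (Dx _ (lt_nbhsl k0)).
have ncod : \forall y \near x, chart_cod (charts i) y.
  by apply: open_nbhs_nbhs; split=> //; exact: chart_cod_open.
apply: filterS2 nD ncod => y Dy cy; split=> // u.
have DU : `|metric_tensor i y u u - metric_tensor i x u u| <= D y * `|u| ^+ 2.
  rewrite !metric_expansion// -sumrB (le_trans (ler_norm_sum _ _ _))//.
  rewrite mulr_suml ler_sum// => p _.
  rewrite -sumrB (le_trans (ler_norm_sum _ _ _))// mulr_suml ler_sum// => q _.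
  rewrite -mulrBr mulrC normrM ler_wpM2l// normrM expr2.
  by apply: ler_pM => //; exact: coord_le_norm.
have ex : D y * `|u| ^+ 2 <= e / (1 + e) * chart_norm i x u ^+ 2.
  have : (c * `|u|) ^+ 2 <= chart_norm i x u ^+ 2.
    by rewrite ler_pXn2r ?nnegrE ?chart_norm_ge0// mulr_ge0// ltW.
  rewrite exprMn => h.
  apply: (@le_trans _ _ (k * `|u| ^+ 2)).
    by rewrite ler_wpM2r ?exprn_ge0// ltW.
  by rewrite /k -mulrA ler_wpM2l// divr_ge0; lra.
move: DU; rewrite -!chart_norm_sqr// ler_norml => /andP[D1 D2].
have ek : e / (1 + e) <= e by rewrite ler_pdivrMr; nra.
have e1 : (1 - e / (1 + e)) * (1 + e) = 1 by field; lra.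
set a := chart_norm i x u in D1 D2 ex *; set b := chart_norm i y u in D1 D2 *.
have a0 : 0 <= a by exact: chart_norm_ge0.
have b0 : 0 <= b by exact: chart_norm_ge0.
set q := e / (1 + e) in ek e1 ex.
have q0 : 0 <= q by rewrite divr_ge0; lra.
have aa : 0 <= a ^+ 2 by exact: exprn_ge0.
split.
  rewrite -(@ler_pXn2r _ 2) ?nnegrE ?mulr_ge0//; last lra.
  rewrite exprMn; have : b ^+ 2 <= (1 + q) * a ^+ 2 by lra.
  move=> /le_trans; apply; rewrite ler_wpM2r//; nra.
rewrite -(@ler_pXn2r _ 2) ?nnegrE ?mulr_ge0//; last lra.
rewrite exprMn; have h : (1 - q) * a ^+ 2 <= b ^+ 2 by lra.
have h1 : (1 + e) ^+ 2 * ((1 - q) * a ^+ 2) <= (1 + e) ^+ 2 * b ^+ 2.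
  by rewrite ler_wpM2l ?exprn_ge0//; lra.
apply: le_trans h1.
have -> : (1 + e) ^+ 2 * ((1 - q) * a ^+ 2) = (1 + e) * a ^+ 2 * ((1 - q) * (1 + e)) by ring.
rewrite e1; nra.
Qed.

End ChartNorm.

(** * The speed of a curve *)

Section Curves.
Context {R : realType} {n : nat} (M : riemannian_manifold R n).
Implicit Types (sigma : R -> M) (i j : chart_index M).

Lemma transition_domP i j (p : M) : chart_dom (charts i) p ->
  chart_dom (charts j) p -> transition_dom (charts i) (charts j) (charts i p).
Proof. by move=> ip jp; split; [exact: chart_mapP|rewrite /= chart_mapK]. Qed.

Lemma transition_differentiable i j x :
  transition_dom (charts i) (charts j) x ->
  differentiable (transition (charts i) (charts j)) x.
Proof. by move=> dx; have [+ _] := transition_smooth i j 1; apply. Qed.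

Lemma chart_dom_near sigma t i : {for t, continuous sigma} ->
  chart_dom (charts i) (sigma t) -> \forall s \near t, chart_dom (charts i) (sigma s).
Proof.
by move=> ct it; apply: ct; apply: open_nbhs_nbhs; split=> //; exact: chart_dom_open.
Qed.

(** Chain rule for the transition map. *)
Lemma derive_chart_change sigma t i j : {for t, continuous sigma} ->
  chart_dom (charts i) (sigma t) -> chart_dom (charts j) (sigma t) ->
  derivable (charts i \o sigma) t 1 ->
  derivable (charts j \o sigma) t 1 /\
  'D_1 (charts j \o sigma) t = 'd (transition (charts i) (charts j))
     (charts i (sigma t)) ('D_1 (charts i \o sigma) t).
Proof.
move=> ct it jt di.
pose tau := transition (charts i) (charts j).
have E : \forall s \near t, (tau \o (charts i \o sigma)) s = (charts j \o sigma) s.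
  apply: filterS (chart_dom_near ct it) => s is_.
  by rewrite /tau/= /transition /= chart_mapK.
have dtau : differentiable tau (charts i (sigma t)).
  by apply: transition_differentiable; exact: transition_domP.
have dsi := (derivable1_diffP _ _).1 di.
have dc : differentiable (tau \o (charts i \o sigma)) t.
  exact: differentiable_comp.
have dc1 := (derivable1_diffP _ _).2 dc.
have E' : {near t, charts j \o sigma =1 tau \o (charts i \o sigma)}.
  by apply: filterS E.
split; first exact: near_eq_derivable E dc1.
rewrite (near_eq_derive _ E').
by rewrite (deriveE _ dc) (diff_comp dsi dtau) /= (deriveE _ dsi).
Qed.

(** By the chain rule, as the transition map carries the metric tensor of one chart to
    that of the other. *)
Lemma speedE sigma t i : {for t, continuous sigma} ->
  chart_dom (charts i) (sigma t) -> derivable (charts i \o sigma) t 1 ->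
  speed sigma t = chart_norm i (charts i (sigma t)) ('D_1 (charts i \o sigma) t).
Proof.
move=> ct it di.
have jt : chart_dom (charts (local_chart sigma t)) (sigma t) by exact: chart_atP.
have [dj dE] := derive_chart_change ct it jt di.
rewrite /speed /local_curve dE /chart_norm.
rewrite (metric_compat (transition_domP it jt)).
by rewrite /transition /= chart_mapK.
Qed.

Lemma speed_ge0 sigma t : 0 <= speed sigma t.
Proof. exact: sqrtr_ge0. Qed.

(** Continuity of a curve is only part of [C1_at] at the point itself; at the
    nearby ones it follows from differentiability of the coordinates. *)
Lemma C1_at_near sigma t : C1_at sigma t -> \forall s \near t,
  [/\ {for s, continuous sigma},
      chart_dom (charts (local_chart sigma t)) (sigma s) &
      derivable (local_curve sigma t) s 1].
Proof.
move=> [ct dt _]; set i := local_chart sigma t.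
have it : chart_dom (charts i) (sigma t) by exact: chart_atP.
have E := chart_dom_near ct it.
have {}E := near_join E.
apply: filterS2 E dt => s Es ds; split=> //; last exact: nbhs_singleton Es.
have cx : {for s, continuous (local_curve sigma t)}.
  by apply: differentiable_continuous; exact/derivable1_diffP.
have is_ : chart_dom (charts i) (sigma s) by exact: nbhs_singleton Es.
have cs : chart_inv (charts i) \o local_curve sigma t @ s --> sigma s.
  rewrite -[X in _ --> X](chart_mapK is_).
  apply: (cvg_comp (local_curve sigma t) (chart_inv (charts i)) cx).
  by apply: chart_inv_continuous; exact: chart_mapP.
apply: cvg_trans cs; apply: near_eq_cvg.
by apply: filterS Es => r ir; rewrite /= chart_mapK.
Qed.

Lemma C1_at_derivable sigma t i : C1_at sigma t ->
  chart_dom (charts i) (sigma t) -> derivable (charts i \o sigma) t 1.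
Proof.
move=> /[dup] H [ct dt _] it.
have jt : chart_dom (charts (local_chart sigma t)) (sigma t) by exact: chart_atP.
have [] := derive_chart_change ct jt it _ => //.
exact: nbhs_singleton dt.
Qed.

(** The chart that defines the speed jumps from point to point without any
    regularity; by [speedE] the chart selected at [t] may be kept for all nearby
    points. *)
Lemma speed_continuous sigma t :
  C1_at sigma t -> {for t, continuous (speed sigma)}.
Proof.
move=> /[dup] H [ct dt ddt]; set i := local_chart sigma t.
have it : chart_dom (charts i) (sigma t) by exact: chart_atP.
have cx : {for t, continuous (local_curve sigma t)}.
  apply: differentiable_continuous; apply/derivable1_diffP.
  exact: nbhs_singleton dt.
have H1 := chart_norm_cvg (FF := nbhs_filter t) (chart_mapP it) cx ddt.
rewrite /prop_for /continuous_at {2}/speed -/i.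
apply: cvg_trans H1; apply: near_eq_cvg.
by apply: filterS (C1_at_near H) => s [cs is_ ds]; rewrite -speedE.
Qed.

(** The link between curves and coordinates: to first order, a curve moves in the
    norm of the tangent space at the speed that its length integrates. *)
Lemma chart_increment sigma t i (e : R) : C1_at sigma t ->
  chart_dom (charts i) (sigma t) -> 0 < e ->
  \forall s \near t, chart_dom (charts i) (sigma s) /\
    chart_norm i (charts i (sigma t)) (charts i (sigma s) - charts i (sigma t))
      <= (speed sigma t + e) * `|s - t|.
Proof.
move=> H it e0; have [ct _ _] := H.
have di := C1_at_derivable H it.
have cx := chart_mapP it.
have [C C0 hC] := chart_norm_upper cx.
have eC : 0 < e / C by rewrite divr_gt0.
apply: filterS2 (chart_dom_near ct it) (derivable_expansion di eC) => s is_ xs.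
split=> //; set x := charts i \o sigma.
have -> : charts i (sigma s) - charts i (sigma t) =
   (s - t) *: 'D_1 x t + (x s - x t - (s - t) *: 'D_1 x t).
  by rewrite [RHS]addrC subrK.
apply: le_trans (chart_normD cx _ _) _.
rewrite mulrDl lerD//.
  by rewrite chart_normZ// mulrC -speedE.
apply: le_trans (hC _) _; rewrite -ler_pdivlMl//.
by apply: le_trans xs _; rewrite mulrA [C^-1 * e]mulrC.
Qed.

End Curves.

(** * Integration over compact intervals *)

Lemma integrableU d (T : measurableType d) (R : realType)
    (mu : {measure set T -> \bar R}) (A B : set T) (f : T -> \bar R) :
  measurable A -> measurable B -> [disjoint A & B] ->
  mu.-integrable A f -> mu.-integrable B f -> mu.-integrable (A `|` B) f.
Proof.
move=> mA mB AB /integrableP[mfA iA] /integrableP[mfB iB].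
have mf := (measurable_funU _ mA mB).2 (conj mfA mfB).
apply/integrableP; split=> //.
rewrite ge0_integral_setU//; first exact: lte_add_pinfty.
exact: measurableT_comp.
Qed.

Section Integrals.
Context {R : realType}.
Implicit Types (f g : R -> R) (a b : R).
Local Notation mu := (@lebesgue_measure R).

Lemma integrable_set1 a f : mu.-integrable [set a] (EFin \o f).
Proof.
apply/integrableP; split; first exact: measurable_fun_set1.
by rewrite integral_set1.
Qed.

Lemma eq_integrable_itvoo a b f g : {in `]a, b[, f =1 g} ->
  mu.-integrable `]a, b[ (EFin \o f) -> mu.-integrable `]a, b[ (EFin \o g).
Proof.
by move=> E fi; apply: eq_integrable fi => // t; rewrite inE => tab /=; rewrite E.
Qed.

Lemma integrable_itvoo_itvcc a b f : a < b ->
  mu.-integrable `]a, b[ (EFin \o f) -> mu.-integrable `[a, b] (EFin \o f).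
Proof.
move=> ab iab.
have iab' : mu.-integrable `]a, b] (EFin \o f).
  rewrite -(@setUitv1 _ R (BRight a) b true) ?bnd_simp//; apply: integrableU => //.
    by apply/disj_setPLR => x /=; rewrite in_itv/= => /andP[_ xb] /eqP; rewrite lt_eqF.
  exact: integrable_set1.
rewrite -(@setU1itv _ R (BRight b) a false) ?bnd_simp ?ltW//; apply: integrableU => //.
  by apply/disj_setPLR => x /= ->; rewrite in_itv/= ltxx.
exact: integrable_set1.
Qed.

Lemma Rintegral_itvcc_itvoo a b f : mu.-integrable `[a, b] (EFin \o f) ->
  \int[mu]_(x in `[a, b]) f x = \int[mu]_(x in `]a, b[) f x.
Proof.
move=> iab; rewrite -Rintegral_itv_bndo_bndc; last first.
  by apply: integrableS iab => //; apply: subset_itvl; rewrite bnd_simp.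
rewrite -Rintegral_itv_obnd_cbnd//.
by apply: integrableS iab => //; apply: subset_itv; rewrite bnd_simp.
Qed.

Lemma eq_Rintegral_itvoo a b f g : mu.-integrable `[a, b] (EFin \o f) ->
  mu.-integrable `[a, b] (EFin \o g) -> {in `]a, b[, f =1 g} ->
  \int[mu]_(x in `[a, b]) f x = \int[mu]_(x in `[a, b]) g x.
Proof.
move=> fi gi E; rewrite (Rintegral_itvcc_itvoo fi) (Rintegral_itvcc_itvoo gi).
by apply: eq_Rintegral => t; rewrite inE; exact: E.
Qed.

Lemma Rintegral_cat a b c f : a <= b -> b <= c ->
  mu.-integrable `[a, c] (EFin \o f) ->
  \int[mu]_(x in `[a, c]) f x =
  \int[mu]_(x in `[a, b]) f x + \int[mu]_(x in `[b, c]) f x.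
Proof.
move=> ab bc iac.
have := Rintegral_itvB (x := b) iac; rewrite !bnd_simp => /(_ ab bc) H.
have ibc : mu.-integrable `]b, c] (EFin \o f).
  by apply: integrableS iac => //; apply: subset_itvr; rewrite bnd_simp.
by rewrite -(Rintegral_itv_obnd_cbnd ibc) -H addrC subrK.
Qed.

Lemma integrable_cat a b c f : a <= b -> b <= c ->
  mu.-integrable `[a, b] (EFin \o f) -> mu.-integrable `[b, c] (EFin \o f) ->
  mu.-integrable `[a, c] (EFin \o f).
Proof.
move=> ab bc iab ibc.
rewrite (@itv_bndbnd_setU _ _ _ (BRight b)) ?bnd_simp//; apply: integrableU => //.
  apply/disj_setPLR => x /=; rewrite !in_itv/= => /andP[_ xb].
  by rewrite ltNge xb.
by apply: integrableS ibc => //; apply: subset_itvr; rewrite bnd_simp.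
Qed.

Lemma Rintegral_itv_cst a b k : a <= b ->
  \int[mu]_(x in `[a, b]) k = k * (b - a).
Proof.
move=> ab; rewrite Rintegral_cst//= lebesgue_measure_itv/= lte_fin.
by case: ltP => [//|ba]; rewrite (le_anti (introT andP (conj ab ba))) subrr.
Qed.

Lemma Rintegral_le_cst a b f k : a <= b -> mu.-integrable `[a, b] (EFin \o f) ->
  (forall x, a <= x <= b -> f x <= k) ->
  \int[mu]_(x in `[a, b]) f x <= k * (b - a).
Proof.
move=> ab fi fk; rewrite -Rintegral_itv_cst//; apply: le_Rintegral => //.
apply: continuous_compact_integrable; first exact: segment_compact.
by apply: continuous_subspaceT => x; exact: cvg_cst.
Qed.

Lemma Rintegral_ge_cst a b f k : a <= b -> mu.-integrable `[a, b] (EFin \o f) ->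
  (forall x, a <= x <= b -> k <= f x) ->
  k * (b - a) <= \int[mu]_(x in `[a, b]) f x.
Proof.
move=> ab fi fk; rewrite -Rintegral_itv_cst//; apply: le_Rintegral => //.
apply: continuous_compact_integrable; first exact: segment_compact.
by apply: continuous_subspaceT => x; exact: cvg_cst.
Qed.

End Integrals.

(** * Piecewise C1 curves and their lengths *)

Section Lengths.
Context {R : realType} {n : nat} (M : riemannian_manifold R n).
Implicit Types (gamma sigma : R -> M) (a b s t : R).
Local Notation mu := (@lebesgue_measure R).

Definition C1_curve sigma a b := forall t, a <= t <= b -> C1_at sigma t.

(** The speed is local, so a curve and its C1 extension have the same speed inside
    the interval; at the end points they may differ, which does not affect the
    length. *)
Lemma near_eq_speed gamma sigma t :
  (\forall s \near t, gamma s = sigma s) -> speed gamma t = speed sigma t.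
Proof.
move=> E; have Et := nbhs_singleton E; rewrite /speed.
have ci : local_chart gamma t = local_chart sigma t by rewrite /local_chart Et.
have Ex : \forall s \near t, local_curve gamma t s = local_curve sigma t s.
  by apply: filterS E => s; rewrite /local_curve ci /= => ->.
by rewrite (near_eq_derive _ Ex) (nbhs_singleton Ex) ci.
Qed.

Lemma C1_on_curve gamma a b : C1_on gamma a b ->
  exists sigma, [/\ C1_curve sigma a b, {in `[a, b], gamma =1 sigma} &
    {in `]a, b[, speed gamma =1 speed sigma}].
Proof.
move=> [sigma gs sC]; exists sigma; split; [exact: sC|exact: gs|].
move=> t tab; apply: near_eq_speed.
apply: filterS (near_in_itvoo tab) => s sab; apply: gs; exact: subset_itv_oo_cc sab.
Qed.

Lemma C1_curve_integrable sigma a b : C1_curve sigma a b ->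
  mu.-integrable `[a, b] (EFin \o speed sigma).
Proof.
move=> sC; apply: continuous_compact_integrable; first exact: segment_compact.
apply: continuous_in_subspaceT => t; rewrite inE /= in_itv /= => tab.
exact/speed_continuous/sC.
Qed.

Lemma C1_on_integrable gamma a b : a < b -> C1_on gamma a b ->
  mu.-integrable `[a, b] (EFin \o speed gamma).
Proof.
move=> ab /C1_on_curve[sigma [sC _ E]]; apply: integrable_itvoo_itvcc => //.
apply: (@eq_integrable_itvoo _ _ _ (speed sigma)).
  by move=> t tab; rewrite E.
apply: integrableS (C1_curve_integrable sC) => //.
by apply: subset_itv; rewrite bnd_simp.
Qed.

Lemma C1_on_length gamma a b : a < b -> C1_on gamma a b ->
  exists sigma, [/\ C1_curve sigma a b, {in `[a, b], gamma =1 sigma} &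
    curve_length gamma a b = curve_length sigma a b].
Proof.
move=> ab Cg; have gi := C1_on_integrable ab Cg.
have [sigma [sC gs E]] := C1_on_curve Cg.
exists sigma; split; [exact: sC|exact: gs|].
exact: eq_Rintegral_itvoo gi (C1_curve_integrable sC) E.
Qed.

Lemma piecewise_C1_lt gamma a b : piecewise_C1 gamma a b -> a < b.
Proof. by elim=> // {}a {}b c _ ab _; exact: lt_trans. Qed.

Lemma piecewise_C1_integrable gamma a b : piecewise_C1 gamma a b ->
  mu.-integrable `[a, b] (EFin \o speed gamma).
Proof.
elim=> [{}a {}b ab|{}a {}b c ab iab bc ibc]; first exact: C1_on_integrable.
by apply: (@integrable_cat _ _ b) => //; apply/ltW/piecewise_C1_lt; eassumption.
Qed.

Lemma curve_length_ge0 gamma a b : 0 <= curve_length gamma a b.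
Proof. by apply: Rintegral_ge0 => t _; exact: speed_ge0. Qed.

Lemma curve_length_cat gamma a b c : piecewise_C1 gamma a c -> a <= b <= c ->
  curve_length gamma a c = curve_length gamma a b + curve_length gamma b c.
Proof.
move=> /piecewise_C1_integrable ig /andP[ab bc].
exact: Rintegral_cat.
Qed.

Lemma C1_curve_piecewise sigma a b : a < b -> C1_curve sigma a b ->
  piecewise_C1 sigma a b.
Proof.
move=> ab sC; apply: piecewise_C1_arc => //; by exists sigma.
Qed.

Lemma C1_onS gamma a b s t : a <= s -> t <= b ->
  C1_on gamma a b -> C1_on gamma s t.
Proof.
move=> as_ tb [sigma gs sC].
have sub r : r \in `[s, t] -> r \in `[a, b].
  by rewrite !in_itv/= => /andP[sr rt]; rewrite (le_trans as_ sr) (le_trans rt tb).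
by exists sigma => r /sub; [exact: gs|exact: sC].
Qed.

Lemma piecewise_C1S gamma a b s t : piecewise_C1 gamma a b ->
  a <= s -> s < t -> t <= b -> piecewise_C1 gamma s t.
Proof.
move=> gC; elim: gC s t => [{}a {}b ab gC|{}a {}b c ab IHab bc IHbc] s t as_ st tb.
  by apply: piecewise_C1_arc => //; exact: C1_onS gC.
have [tb'|bt] := leP t b; first exact: IHab.
have [bs|sb] := leP b s; first exact: IHbc.
by apply: (@piecewise_C1_cat _ _ _ _ _ b); [exact: IHab|apply: IHbc => //].
Qed.

Lemma eq_piecewise_C1 gamma gamma' a b : {in `[a, b], gamma =1 gamma'} ->
  piecewise_C1 gamma a b -> piecewise_C1 gamma' a b.
Proof.
move=> E gC; elim: gC E => [{}a {}b ab [sigma gs sC]|{}a {}b c ab IHab bc IHbc] E.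
  by apply: piecewise_C1_arc => //; exists sigma => // r rab; rewrite -E// gs.
have ltab := piecewise_C1_lt ab; have ltbc := piecewise_C1_lt bc.
apply: (@piecewise_C1_cat _ _ _ _ _ b); [apply: IHab|apply: IHbc] => r.
  rewrite in_itv/= => /andP[ar rb]; apply: E.
  by rewrite in_itv/= ar (le_trans rb (ltW ltbc)).
rewrite in_itv/= => /andP[ar rb]; apply: E.
by rewrite in_itv/= rb (le_trans (ltW ltab) ar).
Qed.

Lemma eq_curve_length gamma gamma' a b : {in `[a, b], gamma =1 gamma'} ->
  piecewise_C1 gamma a b -> curve_length gamma a b = curve_length gamma' a b.
Proof.
move=> E gC; have gC' := eq_piecewise_C1 E gC.
apply: eq_Rintegral_itvoo (piecewise_C1_integrable gC)
  (piecewise_C1_integrable gC') _ => t tab; apply: near_eq_speed.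
apply: filterS (near_in_itvoo tab) => s sab; apply: E; exact: subset_itv_oo_cc sab.
Qed.

Lemma near_affine (e f t : R) (P : R -> Prop) :
  (\forall s \near e * t + f, P s) -> \forall s \near t, P (e * s + f).
Proof.
move=> H; have c : {for t, continuous (fun s => e * s + f)}.
  by apply: continuousD; [apply: continuousM; [exact: cvg_cst|exact: cvg_id]|exact: cvg_cst].
exact: (c _ H).
Qed.

Section Affine.
Variables (e f : R).
Let aff t := e * t + f.

Let is_derive_aff t : is_derive t (1 : R) aff e.
Proof.
by rewrite /aff; apply: is_derive_eq; rewrite addr0 [_ *: _]mulr1.
Qed.

Let aff_continuous : continuous aff.
Proof.
by move=> t; apply: differentiable_continuous; exact/derivable1_diffP.
Qed.

Lemma derive_affine (V : normedModType R) (x : R -> V) t :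
  derivable x (aff t) 1 ->
  derivable (x \o aff) t 1 /\ 'D_1 (x \o aff) t = e *: 'D_1 x (aff t).
Proof.
move=> dx; have dd := (derivable1_diffP _ _).1 dx.
have da : differentiable aff t by apply/derivable1_diffP.
have dc := differentiable_comp da dd.
split; first exact/derivable1_diffP.
rewrite (deriveE _ dc) (diff_comp da dd) /= -(deriveE _ da) derive_val.
by rewrite (deriveE _ dd) -linearZ addr0.
Qed.

Lemma C1_at_affine sigma t : C1_at sigma (aff t) -> C1_at (sigma \o aff) t.
Proof.
move=> [cs ds dds].
have E : \forall s \near t, derivable (local_curve sigma (aff t)) (aff s) 1.
  exact: near_affine ds.
split.
- by apply: continuous_comp => //; exact: aff_continuous.
- by apply: filterS E => s /derive_affine[].
- have H : e *: 'D_1 (local_curve sigma (aff t)) (aff s) @[s --> t] -->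
      e *: 'D_1 (local_curve sigma (aff t)) (aff t).
    apply: cvgZr; exact: (cvg_comp aff _ (@aff_continuous t) dds).
  rewrite /prop_for /continuous_at.
  rewrite (proj2 (derive_affine (nbhs_singleton E))).
  apply: cvg_trans H; apply: near_eq_cvg.
  by apply: filterS E => s /derive_affine[_ ->].
Qed.

Lemma speed_affine sigma t : C1_at sigma (aff t) ->
  speed (sigma \o aff) t = `|e| * speed sigma (aff t).
Proof.
move=> [_ ds _]; rewrite /speed.
have [_ ->] := derive_affine (nbhs_singleton ds).
rewrite -/(chart_norm _ _ _) chart_normZ//.
by apply: chart_mapP; exact: chart_atP.
Qed.

End Affine.
End Lengths.

Section LengthCalculus.
Context {R : realType} {n : nat} (M : riemannian_manifold R n).
Implicit Types (gamma sigma : R -> M) (a b s t : R).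

Lemma C1_curveS sigma a b s t : a <= s -> t <= b ->
  C1_curve sigma a b -> C1_curve sigma s t.
Proof.
by move=> as_ tb sC r /andP[sr rt]; apply: sC; rewrite (le_trans as_)//= (le_trans rt).
Qed.

Lemma curve_lengthxx gamma a : curve_length gamma a a = 0.
Proof. by rewrite /curve_length set_itv1 Rintegral_set1. Qed.

Lemma C1_curve_length_cat sigma a b c : C1_curve sigma a c -> a <= b <= c ->
  curve_length sigma a c = curve_length sigma a b + curve_length sigma b c.
Proof. by move=> sC /andP[ab bc]; apply: Rintegral_cat => //; exact: C1_curve_integrable. Qed.

Lemma C1_curve_length_le sigma a b k : a <= b -> C1_curve sigma a b ->
  (forall t, a <= t <= b -> speed sigma t <= k) ->
  curve_length sigma a b <= k * (b - a).
Proof. by move=> ab sC; apply: Rintegral_le_cst => //; exact: C1_curve_integrable. Qed.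

Lemma C1_curve_length_ge sigma a b k : a <= b -> C1_curve sigma a b ->
  (forall t, a <= t <= b -> k <= speed sigma t) ->
  k * (b - a) <= curve_length sigma a b.
Proof. by move=> ab sC; apply: Rintegral_ge_cst => //; exact: C1_curve_integrable. Qed.

Lemma curve_length_continuous gamma a b : piecewise_C1 gamma a b ->
  {within `[a, b], continuous (curve_length gamma a)}.
Proof.
move=> pC; apply: parameterized_integral_continuous; first exact/ltW/piecewise_C1_lt/pC.
exact: piecewise_C1_integrable.
Qed.

Local Opaque curve_length.

Lemma curve_length_derivative sigma a b t e : C1_curve sigma a b ->
  a <= t <= b -> 0 < e -> \forall s \near t, a <= s <= b ->
  `|curve_length sigma a s - curve_length sigma a t - speed sigma t * (s - t)|
    <= e * `|s - t|.
Proof.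
move=> sC /andP[at_ tb] e0.
have ct := speed_continuous (sC t (introT andP (conj at_ tb))).
have := ct _ (nbhsx_ballx (speed sigma t) e e0).
move=> /nbhs_ballP[d /= d0 hd].
apply/nbhs_ballP; exists d => //= s; rewrite -ball_normE /= => ts /andP[as_ sb].
have bd r : `|t - r| <= `|t - s| ->
    speed sigma t - e <= speed sigma r <= speed sigma t + e.
  move=> rs; have : ball (speed sigma t) e (speed sigma r).
    by apply: hd; rewrite -ball_normE/=; exact: le_lt_trans ts.
  by rewrite -ball_normE/= distrC ltr_distl => /andP[/ltW -> /ltW ->].
have [st|ts'] := leP s t.
  have bd1 r (sr : s <= r) (rt : r <= t) := bd r ltac:(rewrite !ger0_norm ?subr_ge0//; lra).
  have sC' : C1_curve sigma s t by exact: C1_curveS sC.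
  have ac : C1_curve sigma a t by exact: C1_curveS sC.
  have -> : curve_length sigma a t = curve_length sigma a s + curve_length sigma s t.
    by apply: C1_curve_length_cat => //; rewrite as_ st.
  have u1 : curve_length sigma s t <= (speed sigma t + e) * (t - s).
    apply: C1_curve_length_le => // r /andP[sr rt].
    by case/andP: (bd1 r sr rt).
  have u2 : (speed sigma t - e) * (t - s) <= curve_length sigma s t.
    apply: C1_curve_length_ge => // r /andP[sr rt].
    by case/andP: (bd1 r sr rt).
  rewrite (distrC s) (ger0_norm (x := t - s)) ?subr_ge0// ler_norml.
  by apply/andP; split; nra.
have {ts'} ts' := ltW ts'.
have bd1 r (sr : t <= r) (rt : r <= s) := bd r ltac:(rewrite !ler0_norm ?subr_le0//; lra).
have sC' : C1_curve sigma t s by exact: C1_curveS sC.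
have ac : C1_curve sigma a s by exact: C1_curveS sC.
have -> : curve_length sigma a s = curve_length sigma a t + curve_length sigma t s.
  by apply: C1_curve_length_cat => //; rewrite at_ ts'.
have u1 : curve_length sigma t s <= (speed sigma t + e) * (s - t).
  apply: C1_curve_length_le => // r /andP[sr rt].
  by case/andP: (bd1 r sr rt).
have u2 : (speed sigma t - e) * (s - t) <= curve_length sigma t s.
  apply: C1_curve_length_ge => // r /andP[sr rt].
  by case/andP: (bd1 r sr rt).
rewrite (ger0_norm (x := s - t)) ?subr_ge0// ler_norml.
by apply/andP; split; nra.
Qed.

Lemma C1_curve_lower_bound (f : R -> R) sigma a b : a <= b ->
  C1_curve sigma a b ->
  (forall t, a <= t <= b -> forall e, 0 < e -> \forall s \near t, a <= s <= b ->
    `|f s - f t| <= (speed sigma t + e) * `|s - t|) ->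
  f b - f a <= curve_length sigma a b.
Proof.
move=> ab sC hf.
suff : f b - curve_length sigma a b <= f a - curve_length sigma a a.
  by rewrite curve_lengthxx; lra.
apply: (@dini_nonincreasing _ (fun t => f t - curve_length sigma a t)) => // t tab e e0.
have e2 : 0 < e / 2 by rewrite divr_gt0.
apply: filterS2 (hf t tab _ e2) (curve_length_derivative sC tab e2) => s H1 H2 sab.
move: (H1 sab) (H2 sab); rewrite !ler_norml => /andP[h1 h2] /andP[h3 h4].
split=> [ts|st].
  rewrite (ger0_norm (x := s - t)) ?subr_ge0// in h1 h2 h3 h4; nra.
rewrite (ler0_norm (x := s - t)) ?subr_le0// in h1 h2 h3 h4; nra.
Qed.

(** Being 1-Lipschitz along curves in the infinitesimal sense: the increment at [t]
    is bounded by the speed at [t] alone, which can be checked in a chart. *)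
Definition infinitesimally_lipschitz (f : M -> R) :=
  forall sigma t, C1_at sigma t -> forall e, 0 < e ->
    \forall s \near t, `|f (sigma s) - f (sigma t)| <= (speed sigma t + e) * `|s - t|.

(** Every lower bound on lengths of curves below comes from this one, for a suitable
    test function [f]. *)
Lemma curve_length_lower_bound f gamma a b : infinitesimally_lipschitz f ->
  piecewise_C1 gamma a b -> f (gamma b) - f (gamma a) <= curve_length gamma a b.
Proof.
move=> hf; elim=> [{}a {}b ab gC|{}a {}b c ab IHab bc IHbc].
  have [sigma [sC gs ->]] := C1_on_length ab gC.
  rewrite !gs ?in_itv/= ?lexx ?(ltW ab)//.
  apply: (@C1_curve_lower_bound (f \o sigma)) => // [|t tab e e0]; first exact: ltW.
  by apply: filterS (hf _ _ (sC t tab) e e0) => s.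
have abc := piecewise_C1_cat ab bc.
rewrite (curve_length_cat abc (b := b)) ?(ltW (piecewise_C1_lt _))//; first lra.
by rewrite (ltW (piecewise_C1_lt ab)) (ltW (piecewise_C1_lt bc)).
Qed.

Lemma C1_on_affine gamma (e f : R) a b a' b' : C1_on gamma a' b' ->
  (forall t, t \in `[a, b] -> e * t + f \in `[a', b']) ->
  C1_on (fun t => gamma (e * t + f)) a b.
Proof.
move=> [sigma gs sC] sub; exists (fun t => sigma (e * t + f)).
  by move=> t /sub tab; exact: gs.
by move=> t /sub tab; apply: C1_at_affine; exact: sC.
Qed.

(** Integration by substitution for lengths of reparametrized curves is reduced to
    comparing derivatives. *)
Lemma eq_within_derivative (F G p : R -> R) a b : a <= b ->
  (forall t, a <= t <= b -> forall e, 0 < e -> \forall s \near t, a <= s <= b ->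
     `|F s - F t - p t * (s - t)| <= e * `|s - t|) ->
  (forall t, a <= t <= b -> forall e, 0 < e -> \forall s \near t, a <= s <= b ->
     `|G s - G t - p t * (s - t)| <= e * `|s - t|) ->
  F b - F a <= G b - G a.
Proof.
move=> ab hF hG; suff : F b - G b <= F a - G a by lra.
apply: (@dini_nonincreasing _ (fun t => F t - G t)) => // t tab e e0.
have e2 : 0 < e / 2 by rewrite divr_gt0.
apply: filterS2 (hF t tab _ e2) (hG t tab _ e2) => s H1 H2 sab.
move: (H1 sab) (H2 sab); rewrite !ler_norml => /andP[h1 h2] /andP[h3 h4].
split=> [ts|st].
  rewrite (ger0_norm (x := s - t)) ?subr_ge0// in h1 h2 h3 h4; nra.
rewrite (ler0_norm (x := s - t)) ?subr_le0// in h1 h2 h3 h4; nra.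
Qed.

Lemma C1_curve_shift_length sigma f a b : a <= b ->
  C1_curve sigma (a + f) (b + f) ->
  curve_length (fun t => sigma (1 * t + f)) a b <= curve_length sigma (a + f) (b + f).
Proof.
move=> ab sC.
have sub t : a <= t <= b -> a + f <= 1 * t + f <= b + f.
  by move=> /andP[? ?]; rewrite mul1r !lerD2r; apply/andP.
have sC' : C1_curve (fun t => sigma (1 * t + f)) a b.
  by move=> t /sub tab; apply: C1_at_affine; exact: sC.
pose F t := curve_length (fun t => sigma (1 * t + f)) a t.
pose G t := curve_length sigma (a + f) (1 * t + f).
have F0 : F a = 0 by exact: curve_lengthxx.
have G0 : G a = 0 by rewrite /G mul1r curve_lengthxx.
have Gb : G b = curve_length sigma (a + f) (b + f) by rewrite /G mul1r.
rewrite -Gb -[leLHS]/(F b) -[F b]subr0 -[G b]subr0 -{1}F0 -G0.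
apply: (@eq_within_derivative F G (speed (fun t => sigma (1 * t + f)))) => // t tab e e0.
  exact: curve_length_derivative.
have := curve_length_derivative sC (sub _ tab) e0.
move=> /near_affine; apply: filterS => s hs /sub /hs.
rewrite (speed_affine (sC _ (sub _ tab))) normr1 [1 * speed _ _]mul1r.
by have -> : 1 * s + f - (1 * t + f) = s - t by ring.
Qed.

Lemma C1_curve_rev_length sigma f a b : a <= b ->
  C1_curve sigma (f - b) (f - a) ->
  curve_length (fun t => sigma (-1 * t + f)) a b <= curve_length sigma (f - b) (f - a).
Proof.
move=> ab sC.
have sub t : a <= t <= b -> f - b <= -1 * t + f <= f - a.
  by move=> /andP[? ?]; rewrite mulN1r; apply/andP; split; lra.
have sC' : C1_curve (fun t => sigma (-1 * t + f)) a b.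
  by move=> t /sub tab; apply: C1_at_affine; exact: sC.
pose F t := curve_length (fun t => sigma (-1 * t + f)) a t.
pose G t := - curve_length sigma (f - b) (-1 * t + f).
have F0 : F a = 0 by exact: curve_lengthxx.
have Ga : G a = - curve_length sigma (f - b) (f - a).
  by rewrite /G mulN1r [- _ + f]addrC.
have Gb : G b = 0.
  by rewrite /G mulN1r [- _ + f]addrC curve_lengthxx oppr0.
suff : F b - F a <= G b - G a by rewrite F0 Ga Gb subr0 sub0r opprK.
apply: (@eq_within_derivative F G (speed (fun t => sigma (-1 * t + f)))) => // t tab e e0.
  exact: curve_length_derivative.
have := curve_length_derivative sC (sub _ tab) e0.
move=> /near_affine; apply: filterS => s hs /sub /hs.
rewrite (speed_affine (sC _ (sub _ tab))) normrN1 [1 * speed _ _]mul1r.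
have -> : -1 * s + f - (-1 * t + f) = - (s - t) by ring.
set v := speed sigma _; set L := curve_length _ _.
have -> : G s - G t - v * (s - t) =
    - (L (-1 * s + f) - L (-1 * t + f) - v * - (s - t)) by rewrite /G -/L; ring.
by rewrite !normrN.
Qed.

Lemma piecewise_C1_shift gamma f a b : piecewise_C1 gamma (a + f) (b + f) ->
  piecewise_C1 (fun t => gamma (1 * t + f)) a b /\
  curve_length (fun t => gamma (1 * t + f)) a b <= curve_length gamma (a + f) (b + f).
Proof.
move: {-2}(a + f) (erefl (a + f)) {-2}(b + f) (erefl (b + f)) => a' ea b' eb H.
elim: H a b ea eb => [{}a' {}b' ab gC|{}a' {}b' c ab IHab bc IHbc] a d ea ed.
  have ad : a < d by lra.
  have sub t : t \in `[a, d] -> 1 * t + f \in `[a', b'].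
    by rewrite !in_itv/= mul1r ea ed !lerD2r.
  have pC : piecewise_C1 (fun t => gamma (1 * t + f)) a d.
    by apply: piecewise_C1_arc => //; exact: C1_on_affine gC sub.
  split; first exact: pC.
  have [sigma [sC gs ->]] := C1_on_length ab gC.
  have E : {in `[a, d], (fun t => gamma (1 * t + f)) =1 (fun t => sigma (1 * t + f))}.
    by move=> t /sub /gs.
  rewrite (eq_curve_length E pC) ea ed; apply: C1_curve_shift_length; first exact: ltW.
  by rewrite -ea -ed.
have [b eb] : exists b, b' = b + f by exists (b' - f); rewrite subrK.
have [p1 l1] := IHab a b ea eb; have [p2 l2] := IHbc b d eb ed.
have abd : a <= b <= d.
  by rewrite (ltW (piecewise_C1_lt p1)) (ltW (piecewise_C1_lt p2)).
have p12 := piecewise_C1_cat p1 p2; split; first exact: p12.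
have ltab := piecewise_C1_lt ab; have ltbc := piecewise_C1_lt bc.
rewrite (curve_length_cat p12 abd).
have abc : a' <= b' <= c by rewrite !ltW.
rewrite (curve_length_cat (piecewise_C1_cat ab bc) abc).
exact: lerD l1 l2.
Qed.

Lemma piecewise_C1_rev gamma f a b : piecewise_C1 gamma (f - b) (f - a) ->
  piecewise_C1 (fun t => gamma (-1 * t + f)) a b /\
  curve_length (fun t => gamma (-1 * t + f)) a b <= curve_length gamma (f - b) (f - a).
Proof.
move: {-2}(f - b) (erefl (f - b)) {-2}(f - a) (erefl (f - a)) => a' ea b' eb H.
elim: H a b ea eb => [{}a' {}b' ab gC|{}a' {}b' c ab IHab bc IHbc] a d ed ea.
  have ad : a < d by lra.
  have sub t : t \in `[a, d] -> -1 * t + f \in `[a', b'].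
    by rewrite !in_itv/= mulN1r ea ed => /andP[? ?]; apply/andP; split; lra.
  have pC : piecewise_C1 (fun t => gamma (-1 * t + f)) a d.
    by apply: piecewise_C1_arc => //; exact: C1_on_affine gC sub.
  split; first exact: pC.
  have [sigma [sC gs ->]] := C1_on_length ab gC.
  have E : {in `[a, d], (fun t => gamma (-1 * t + f)) =1 (fun t => sigma (-1 * t + f))}.
    by move=> t /sub /gs.
  rewrite (eq_curve_length E pC) ea ed; apply: C1_curve_rev_length; first exact: ltW.
  by rewrite -ea -ed.
have [b eb] : exists b, b' = f - b by exists (f - b'); rewrite opprB addrC subrK.
have [p1 l1] := IHab b d ed eb; have [p2 l2] := IHbc a b eb ea.
have abd : a <= b <= d.
  by rewrite (ltW (piecewise_C1_lt p2)) (ltW (piecewise_C1_lt p1)).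
have p12 := piecewise_C1_cat p2 p1; split; first exact: p12.
have ltab := piecewise_C1_lt ab; have ltbc := piecewise_C1_lt bc.
rewrite (curve_length_cat p12 abd).
have abc : a' <= b' <= c by rewrite !ltW.
rewrite (curve_length_cat (piecewise_C1_cat ab bc) abc) [leRHS]addrC.
exact: lerD l2 l1.
Qed.

End LengthCalculus.

(** * The geodesic distance *)

Local Opaque curve_length.

Section Distance.
Context {R : realType} {n : nat} (M : riemannian_manifold R n).
Implicit Types (gamma sigma : R -> M) (a b s t : R) (P Q : M) (i j : chart_index M).

Section ChartLine.
Variables (i : chart_index M) (x v : 'rV[R]_n).
(** Straight segments of a chart, used as competitors for the distance. *)
Definition chart_line t : M := chart_inv (charts i) (x + t *: v).

Let ell (t : R) : 'rV[R]_n := x + t *: v.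

Let is_derive_ell t : is_derive t (1 : R) ell v.
Proof.
have dv : is_derive t (1 : R) ( *:%R^~ v : R -> 'rV[R]_n) v.
  have did : differentiable (id : R -> R) t by [].
  have dL : differentiable ( *:%R^~ v : R -> 'rV[R]_n) t.
    exact: (@differentiableZl _ _ _ id v t did).
  apply: DeriveDef; first exact/derivable1_diffP.
  by rewrite (deriveE _ dL) (@diffZl _ _ _ id v t did) /= diff_val scale1r.
by apply: is_derive_eq; rewrite add0r.
Qed.

Let ell_differentiable t : differentiable ell t.
Proof. by apply/derivable1_diffP; case: (is_derive_ell t). Qed.

Let ell_continuous : continuous ell.
Proof. by move=> t; exact: differentiable_continuous (ell_differentiable t). Qed.

Variable t : R.
Hypothesis ct : chart_cod (charts i) (ell t).

Lemma chart_line_dom : chart_dom (charts i) (chart_line t).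
Proof. exact: chart_invP. Qed.

Lemma chart_line_continuous : {for t, continuous chart_line}.
Proof.
apply: (cvg_comp ell (chart_inv (charts i)) (@ell_continuous t)).
exact: chart_inv_continuous.
Qed.

Lemma chart_line_C1 : C1_at chart_line t.
Proof.
pose j := local_chart chart_line t; pose tau := transition (charts i) (charts j).
have dom_t : transition_dom (charts i) (charts j) (ell t).
  by split=> //; exact: chart_atP.
have dom_near : \forall s \near t, transition_dom (charts i) (charts j) (ell s).
  apply: (@ell_continuous t); apply: open_nbhs_nbhs; split=> //.
  exact: transition_dom_open.
have D s : transition_dom (charts i) (charts j) (ell s) ->
    derivable (tau \o ell) s 1 /\ 'D_1 (tau \o ell) s = 'd tau (ell s) v.
  move=> /transition_differentiable dtau.
  have de := ell_differentiable s.
  have dc := differentiable_comp de dtau.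
  split; first exact/derivable1_diffP.
  by rewrite (deriveE _ dc) (diff_comp de dtau) /= -(deriveE _ de); case: (is_derive_ell s) => _ ->.
split; first exact: chart_line_continuous.
- by apply: filterS dom_near => s /D[].
- have [_ /(_ v) c2] := transition_smooth i j 1.
  have H : 'd tau (ell s) v @[s --> t] --> 'd tau (ell t) v.
    exact: (cvg_comp ell (fun y => 'd tau y v) (@ell_continuous t) (c2 _ dom_t)).
  rewrite /prop_for /continuous_at.
  rewrite -[local_curve _ _]/(tau \o ell) (proj2 (D _ dom_t)).
  apply: cvg_trans H; apply: near_eq_cvg.
  by apply: filterS dom_near => s /D[_ ->].
Qed.

Lemma chart_line_speed : speed chart_line t = chart_norm i (x + t *: v) v.
Proof.
have E : \forall s \near t, (charts i \o chart_line) s = ell s.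
  have : \forall s \near t, chart_cod (charts i) (ell s).
    apply: (@ell_continuous t); apply: open_nbhs_nbhs; split=> //.
    exact: chart_cod_open.
  by apply: filterS => s cs; rewrite /= chart_invK.
have E' : \forall s \near t, ell s = (charts i \o chart_line) s.
  by apply: filterS E.
rewrite (speedE chart_line_continuous chart_line_dom); last first.
  by apply: near_eq_derivable E' _; case: (is_derive_ell t).
rewrite (near_eq_derive _ E); case: (is_derive_ell t) => _ ->.
by rewrite /chart_line chart_invK.
Qed.

End ChartLine.

Definition joined P Q := exists gamma a b,
  [/\ piecewise_C1 gamma a b, gamma a = P & gamma b = Q].

Lemma concatenate_curves P Q T gamma gamma' a b c d :
  piecewise_C1 gamma a b -> gamma a = P -> gamma b = Q ->
  piecewise_C1 gamma' c d -> gamma' c = Q -> gamma' d = T ->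
  exists gamma'' a' b', [/\ piecewise_C1 gamma'' a' b', gamma'' a' = P,
    gamma'' b' = T &
    curve_length gamma'' a' b' <= curve_length gamma a b + curve_length gamma' c d].
Proof.
move=> pC gaP gbQ pC' gcQ gdT.
have ab := piecewise_C1_lt pC; have cd := piecewise_C1_lt pC'.
pose f := c - b; pose e := d - f.
have cE : c = b + f by rewrite addrC subrK.
have dE : d = e + f by rewrite subrK.
have pC2 : piecewise_C1 gamma' (b + f) (e + f) by rewrite -cE -dE.
have [pS lS] := piecewise_C1_shift pC2.
have be := piecewise_C1_lt pS.
pose g3 t := if t <= b then gamma t else gamma' (1 * t + f).
have E1 : {in `[a, b], gamma =1 g3}.
  by move=> t; rewrite in_itv/= /g3 => /andP[_ ->].
have E2 : {in `[b, e], (fun t => gamma' (1 * t + f)) =1 g3}.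
  move=> t; rewrite in_itv/= /g3 => /andP[bt _].
  have [tb|//] := leP t b; have -> : t = b by apply: le_anti; rewrite tb.
  by rewrite mul1r -cE gcQ gbQ.
have p1 := eq_piecewise_C1 E1 pC; have p2 := eq_piecewise_C1 E2 pS.
have p3 := piecewise_C1_cat p1 p2.
exists g3, a, e; split; first exact: p3.
- by rewrite /g3 (ltW ab).
- by rewrite /g3 leNgt be/= mul1r -dE.
- have abe : a <= b <= e by rewrite !ltW.
  rewrite (curve_length_cat p3 abe) -(eq_curve_length E1 pC) -(eq_curve_length E2 pS).
  by rewrite lerD2l cE dE.
Qed.

Lemma reverse_curve P Q gamma a b : piecewise_C1 gamma a b -> gamma a = P ->
  gamma b = Q -> exists gamma' a' b', [/\ piecewise_C1 gamma' a' b', gamma' a' = Q,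
    gamma' b' = P & curve_length gamma' a' b' <= curve_length gamma a b].
Proof.
move=> pC gaP gbQ; pose f := a + b.
have aE : a = f - b by rewrite addrK.
have bE : b = f - a by rewrite /f addrC addKr.
have pC2 : piecewise_C1 gamma (f - b) (f - a) by rewrite -aE -bE.
have [pS lS] := piecewise_C1_rev pC2.
exists (fun t => gamma (-1 * t + f)), a, b; split; first exact: pS.
- by rewrite mulN1r addrC -bE.
- by rewrite mulN1r addrC -aE.
- by rewrite [X in _ <= curve_length _ X _]aE [X in _ <= curve_length _ _ X]bE.
Qed.

Lemma joined_sym P Q : joined P Q -> joined Q P.
Proof.
move=> [g [a [b [pC ga gb]]]].
by have [g' [a' [b' [? ? ? _]]]] := reverse_curve pC ga gb; exists g', a', b'.
Qed.

Lemma joined_trans P Q T : joined P Q -> joined Q T -> joined P T.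
Proof.
move=> [g [a [b [pC ga gb]]]] [g' [c [d [pC' gc gd]]]].
have [h [a' [b' [? ? ? _]]]] := concatenate_curves pC ga gb pC' gc gd.
by exists h, a', b'.
Qed.

Lemma geodesic_dist_ge0 P Q : 0 <= geodesic_dist M P Q.
Proof.
rewrite /geodesic_dist; set S := (X in inf X).
have [->|/set0P S0] := eqVneq S set0; first by rewrite inf0.
apply: lb_le_inf => // _ [g [a [b [_ _ _ ->]]]]; exact: curve_length_ge0.
Qed.

Lemma geodesic_dist_le gamma a b : piecewise_C1 gamma a b ->
  geodesic_dist M (gamma a) (gamma b) <= curve_length gamma a b.
Proof.
move=> pC; apply: ge_inf; last by exists gamma, a, b.
by exists 0 => _ [g [c [d [_ _ _ ->]]]]; exact: curve_length_ge0.
Qed.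

Lemma geodesic_dist_ge P Q (k : R) : joined P Q ->
  (forall gamma a b, piecewise_C1 gamma a b -> gamma a = P -> gamma b = Q ->
    k <= curve_length gamma a b) -> k <= geodesic_dist M P Q.
Proof.
move=> [g [a [b [pC ga gb]]]] H; apply: lb_le_inf.
  by exists (curve_length g a b), g, a, b.
by move=> _ [g' [a' [b' [pC' ga' gb' ->]]]]; exact: H.
Qed.

(** By the length of the straight segment, on which the metric is almost constant. *)
Lemma dist_chart_coord_upper i x (e : R) : chart_cod (charts i) x -> 0 < e ->
  \forall y \near x, [/\ chart_cod (charts i) y,
    joined (chart_inv (charts i) x) (chart_inv (charts i) y) &
    geodesic_dist M (chart_inv (charts i) x) (chart_inv (charts i) y) <=
      (1 + e) * chart_norm i x (y - x)].
Proof.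
move=> cx e0.
have /nbhs_ballP[d /= d0 hd] := chart_norm_near cx e0.
apply/nbhs_ballP; exists d => //= y xy.
have inball t : 0 <= t <= 1 -> ball x d (x + t *: (y - x)).
  move=> /andP[t0 t1]; move: xy; rewrite -!ball_normE/= opprD addNKr normrN.
  rewrite normrZ ger0_norm// -normrN opprB => xy.
  by apply: le_lt_trans xy; rewrite ler_piMl.
have sC : C1_curve (chart_line i x (y - x)) 0 1.
  by move=> t /inball /hd[ct _]; exact: chart_line_C1.
have p := C1_curve_piecewise ltr01 sC.
have l0 : chart_line i x (y - x) 0 = chart_inv (charts i) x.
  by rewrite /chart_line scale0r addr0.
have l1 : chart_line i x (y - x) 1 = chart_inv (charts i) y.
  by rewrite /chart_line scale1r addrC subrK.
split; first by case: (hd _ xy).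
  by exists (chart_line i x (y - x)), 0, 1.
rewrite -l0 -l1; apply: le_trans (geodesic_dist_le p) _.
rewrite -[leRHS]mulr1 -[X in _ <= _ * X](subr0 1).
apply: C1_curve_length_le => // t /inball /hd[ct /(_ (y - x))[h _]].
by rewrite chart_line_speed.
Qed.

Lemma dist_chart_upper i P (e : R) : chart_dom (charts i) P -> 0 < e ->
  \forall Q \near P, [/\ chart_dom (charts i) Q, joined P Q &
    geodesic_dist M P Q <=
      (1 + e) * chart_norm i (charts i P) (charts i Q - charts i P)].
Proof.
move=> iP e0.
have := chart_map_continuous iP (dist_chart_coord_upper (chart_mapP iP) e0).
have : \forall Q \near P, chart_dom (charts i) Q.
  by apply: open_nbhs_nbhs; split=> //; exact: chart_dom_open.
by apply: filterS2 => Q iQ [_]; rewrite !chart_mapK.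
Qed.

Lemma joined_near P : \forall Q \near P, joined P Q.
Proof.
by apply: filterS (dist_chart_upper (chart_atP P) ltr01) => Q [].
Qed.

(** The points joined to [P] form an open and closed set, since neighbouring points
    are joined by a straight segment of a chart. *)
Lemma joinedT P Q : joined P Q.
Proof.
pose A := [set T | joined P T].
have AP : A P by exact: nbhs_singleton (joined_near P).
have oA : open A.
  rewrite openE => T PT; apply: filterS (joined_near T) => S; exact: joined_trans.
have cA : closed A.
  rewrite -[A]setCK closedC openE => T nPT.
  apply: filterS (joined_near T) => S TS PS; apply: nPT.
  exact: joined_trans PS (joined_sym TS).
have : A = setT.
  apply: (manifold_connected (m := M)); first by exists P.
    by exists A => //; rewrite setTI.
  by exists A => //; rewrite setTI.
by move=> /seteqP[_ /(_ Q I)].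
Qed.

Lemma geodesic_dist_near_minimal P Q (e : R) : 0 < e -> exists gamma a b,
  [/\ piecewise_C1 gamma a b, gamma a = P, gamma b = Q &
      curve_length gamma a b < geodesic_dist M P Q + e].
Proof.
move=> e0; have [g [a [b [pC ga gb]]]] := joinedT P Q.
rewrite /geodesic_dist; set S := [set _ | _].
have hS : has_inf S.
  split; first by exists (curve_length g a b), g, a, b.
  by exists 0 => _ [g' [c [d [_ _ _ ->]]]]; exact: curve_length_ge0.
have [_ [g' [a' [b' [pC' ga' gb' ->]]]] lt] := inf_adherent e0 hS.
by exists g', a', b'.
Qed.

Lemma geodesic_distxx P : geodesic_dist M P P = 0.
Proof.
apply: le_anti; rewrite geodesic_dist_ge0 andbT.
have := nbhs_singleton (dist_chart_upper (chart_atP P) ltr01).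
rewrite subrr => -[_ _] /le_trans; apply.
rewrite -(scale0r (0 : 'rV[R]_n)) chart_normZ ?normr0 ?mul0r ?mulr0//.
by apply: chart_mapP; exact: chart_atP.
Qed.

Lemma geodesic_dist_sym P Q : geodesic_dist M P Q = geodesic_dist M Q P.
Proof.
suff H P' Q' : geodesic_dist M P' Q' <= geodesic_dist M Q' P'.
  by apply: le_anti; rewrite !H.
apply: geodesic_dist_ge => [|g a b pC ga gb]; first exact: joinedT.
have [g' [a' [b' [pC' <- <- le]]]] := reverse_curve pC ga gb.
exact: le_trans (geodesic_dist_le pC') le.
Qed.

Lemma geodesic_dist_triangle Q P T :
  geodesic_dist M P T <= geodesic_dist M P Q + geodesic_dist M Q T.
Proof.
rewrite -lerBlDr; apply: geodesic_dist_ge => [|g a b pC ga gb]; first exact: joinedT.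
rewrite lerBlDr -lerBlDl; apply: geodesic_dist_ge => [|g' a' b' pC' ga' gb'].
  exact: joinedT.
rewrite lerBlDl.
have [h [c [d [pC'' <- <- le]]]] := concatenate_curves pC ga gb pC' ga' gb'.
exact: le_trans (geodesic_dist_le pC'') le.
Qed.

Lemma geodesic_dist_lipschitz T P Q :
  `|geodesic_dist M T P - geodesic_dist M T Q| <= geodesic_dist M P Q.
Proof.
have h1 := geodesic_dist_triangle P T Q; have h2 := geodesic_dist_triangle Q T P.
rewrite (geodesic_dist_sym Q P) in h2.
by rewrite ler_norml; apply/andP; split; lra.
Qed.

Lemma lipschitz_geodesic_dist f P Q : infinitesimally_lipschitz f ->
  f Q - f P <= geodesic_dist M P Q.
Proof.
move=> hf; apply: geodesic_dist_ge => [|g a b pC <- <-]; first exact: joinedT.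
exact: curve_length_lower_bound.
Qed.

End Distance.

(** * The geodesic distance to first order *)

Section LocalComparison.
Context {R : realType} {n : nat} (M : riemannian_manifold R n).
Implicit Types (sigma : R -> M) (P Q : M) (i : chart_index M).
Local Notation d := (geodesic_dist M).

(** It is the image of a compact set, in a Hausdorff space. *)
Lemma closed_chart_ball i (x : 'rV[R]_n) (r : R) :
  (forall y, `|y - x| <= r -> chart_cod (charts i) y) ->
  closed [set P : M | chart_dom (charts i) P /\ `|charts i P - x| <= r].
Proof.
move=> sub; pose B := [set y : 'rV[R]_n | `|y - x| <= r].
have cB : compact B.
  apply: bounded_closed_compact.
    exists (`|x| + r); split; first exact: num_real.
    move=> k xk y /= By; apply: le_trans (ltW xk).
    rewrite -(subrK x y) addrC; apply: le_trans (ler_normD _ _) _.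
    by rewrite lerD2l.
  have -> : B = (fun y => `|y - x|) @^-1` [set k | k <= r] by [].
  apply: closed_comp => [y _|]; last exact: closed_le.
  have c : {for y, continuous (fun y : 'rV[R]_n => y - x)}.
    by apply: continuousB; [move=> A; exact|exact: cst_continuous].
  exact: (continuous_comp c (@norm_continuous _ _ _)).
have -> : [set P : M | chart_dom (charts i) P /\ `|charts i P - x| <= r] =
    chart_inv (charts i) @` B.
  apply/seteqP; split=> [P [iP Pr]|P [y By <-]].
    by exists (charts i P) => //; rewrite chart_mapK.
  by split; [exact/chart_invP/sub|rewrite chart_invK//; exact: sub].
apply: compact_closed; first exact: manifold_hausdorff.
apply: continuous_compact => //; apply: continuous_in_subspaceT => y; rewrite inE => By.
by apply: chart_inv_continuous; exact: sub.
Qed.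

Lemma min_contraction (r a b : R) :
  `|Num.min r a - Num.min r b| <= `|a - b|.
Proof.
rewrite !minEle; case: (leP r a) => ra; case: (leP r b) => rb //.
- by rewrite subrr normr0.
- rewrite ger0_norm ?subr_ge0 ?(ltW rb)// ger0_norm ?subr_ge0; lra.
- rewrite ler0_norm ?subr_le0 ?(ltW ra)// ler0_norm ?subr_le0; lra.
Qed.

(** The distance to [P] cannot be much smaller than the chart norm.  The test
    function is the chart norm truncated at a level [r2] that it exceeds well
    inside the domain of the chart, and extended by [r2]; it varies along curves at
    most 1 + e times as fast as the arc length, and separates [P] from the points
    outside. *)
Lemma dist_chart_lower i P (e r : R) : chart_dom (charts i) P -> 0 < e -> 0 < r ->
  exists2 rho : R, 0 < rho & forall Q, d P Q < rho ->
    [/\ chart_dom (charts i) Q, `|charts i Q - charts i P| < r &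
      chart_norm i (charts i P) (charts i Q - charts i P) <= (1 + e) * d P Q].
Proof.
move=> iP e0 r0; set x := charts i P.
have cx : chart_cod (charts i) x by exact: chart_mapP.
have /nbhs_ballP[d1 /= d10 hd1] := chart_norm_near cx e0.
have [c c0 hc] := chart_norm_lower cx.
(* The halving keeps the closed ball of radius [r1] inside the open ball of
   radius [d1] where the metric is controlled. *)
pose r1 := Num.min r d1 / 2.
have m0 : 0 < Num.min r d1 by rewrite lt_min r0.
have r10 : 0 < r1 by rewrite divr_gt0.
have r1r : r1 < r.
  by apply: (@lt_le_trans _ _ (Num.min r d1)); [rewrite /r1; lra|rewrite ge_min lexx].
have r1d : r1 < d1.
  by apply: (@lt_le_trans _ _ (Num.min r d1)); [rewrite /r1; lra|rewrite ge_min lexx orbT].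
pose nu := chart_norm i x.
pose U Q := chart_dom (charts i) Q /\ `|charts i Q - x| < d1.
pose r2 := c * r1.
have r20 : 0 < r2 by rewrite mulr_gt0.
pose f Q : R := if pselect (U Q) then Num.min r2 (nu (charts i Q - x)) else r2.
have Unear Q : U Q -> \forall Q' \near Q, U Q'.
  move=> [iQ Qd]; apply: filterI.
    by apply: open_nbhs_nbhs; split=> //; exact: chart_dom_open.
  have c1 : `|charts i Q' - x| @[Q' --> Q] --> `|charts i Q - x|.
    apply: (cvg_norm (f := fun Q' => charts i Q' - x)).
    by apply: cvgB; [exact: chart_map_continuous|exact: cvg_cst].
  exact: (c1 _ (lt_nbhsl Qd)).
pose K := [set Q : M | chart_dom (charts i) Q /\ `|charts i Q - x| <= r1].
have Kcl : closed K.
  apply: closed_chart_ball => y yr; case: (hd1 y) => //.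
  by rewrite -ball_normE/= distrC; exact: le_lt_trans r1d.
have fU Q : U Q -> f Q = Num.min r2 (nu (charts i Q - x)).
  by rewrite /f; case: pselect.
have fK Q : ~ K Q -> f Q = r2.
  rewrite /f; case: pselect => //= -[iQ Qd] nK; apply/min_idPl.
  apply: le_trans (hc _); rewrite ler_pM2l// leNgt; apply/negP => lt.
  by apply: nK; split=> //; exact: ltW.
have IL : infinitesimally_lipschitz (fun Q => (1 + e)^-1 * f Q).
  move=> sigma t sC eta eta0; have [ct _ _] := sC.
  have [Ut|nUt] := pselect (U (sigma t)).
    have [iQ Qd] := Ut.
    have nUs : \forall s \near t, U (sigma s) by exact: (ct _ (Unear _ Ut)).
    apply: filterS2 nUs (chart_increment sC iQ eta0) => s Us [is_ hs].
    rewrite -mulrBr normrM gtr0_norm ?invr_gt0; last lra.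
    rewrite ler_pdivrMl; last lra.
    rewrite !fU//.
    apply: le_trans (min_contraction _ _ _) _.
    apply: le_trans (chart_normB cx _ _) _.
    rewrite opprB addrA subrK.
    have : ball x d1 (charts i (sigma t)) by rewrite -ball_normE/= distrC.
    move=> /hd1[_ /(_ (charts i (sigma s) - charts i (sigma t)))[_ h]].
    by apply: le_trans h _; rewrite ler_pM2l//; lra.
  have nK : ~ K (sigma t).
    by move=> [iQ Qr]; apply: nUt; split=> //; exact: le_lt_trans r1d.
  have : \forall s \near t, (~` K) (sigma s).
    by apply: ct; apply: open_nbhs_nbhs; split=> //; exact: closed_openC.
  apply: filterS => s /fK ->; rewrite (fK _ nK) subrr normr0.
  by rewrite mulr_ge0// addr_ge0 ?speed_ge0 ?ltW.
have fP : f P = 0.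
  rewrite fU; last by split=> //; rewrite subrr normr0.
  rewrite subrr /nu -(scale0r (0 : 'rV[R]_n)) chart_normZ// normr0 mul0r /=.
  by apply/min_idPr; exact: ltW.
exists (r2 / (1 + e)) => [|Q dQ]; first by rewrite divr_gt0//; lra.
have fQ : f Q <= (1 + e) * d P Q.
  have := lipschitz_geodesic_dist P Q IL; rewrite fP mulr0 subr0.
  by rewrite ler_pdivrMl; lra.
have fQr : f Q < r2.
  by apply: le_lt_trans fQ _; rewrite mulrC -ltr_pdivlMr; lra.
have [KQ|/fK] := pselect (K Q); last by move: fQr => /[swap] ->; rewrite ltxx.
have [iQ Qr] := KQ; split=> //; first exact: le_lt_trans r1r.
move: fQ fQr; rewrite fU; last by split=> //; exact: le_lt_trans r1d.
by have [//|_ _] := ltP (nu (charts i Q - x)) r2; rewrite ltxx.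
Qed.

Lemma geodesic_dist_eq0 P Q : d P Q = 0 -> P = Q.
Proof.
move=> dPQ; have iP := chart_atP P.
have [rho rho0 /(_ Q)] := dist_chart_lower iP ltr01 ltr01.
rewrite dPQ mulr0 => /(_ rho0)[iQ _ le0].
have cx := chart_mapP iP.
have /eqP : charts (chart_at P) Q - charts (chart_at P) P = 0.
  by apply: (chart_norm0_eq0 cx); apply: le_anti; rewrite le0 chart_norm_ge0.
by rewrite subr_eq0 => /eqP E; rewrite -(chart_mapK iP) -(chart_mapK iQ) E.
Qed.

End LocalComparison.

(** * Almost minimizing paths *)

Local Opaque geodesic_dist.

Section LengthSpace.
Context {R : realType} {n : nat} (M : riemannian_manifold R n).
Implicit Types (gamma : R -> M) (a b s t : R) (P Q : M).
Local Notation d := (geodesic_dist M).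

(** The function [curve_length gamma a] measures arc length from the origin of the curve. *)
Lemma dist_on_curve gamma a b s t : piecewise_C1 gamma a b ->
  a <= s <= b -> a <= t <= b ->
  d (gamma s) (gamma t) <= `|curve_length gamma a t - curve_length gamma a s|.
Proof.
move=> pC; suff main s' t' : a <= s' -> s' < t' -> t' <= b ->
    d (gamma s') (gamma t') <= `|curve_length gamma a t' - curve_length gamma a s'|.
  move=> /andP[as_ sb] /andP[at_ tb].
  have [st|ts|->] := ltgtP s t; first exact: main.
    by rewrite geodesic_dist_sym distrC main.
  by rewrite geodesic_distxx.
move=> as_ st tb; have pS := piecewise_C1S pC as_ st tb.
have -> : curve_length gamma a t' = curve_length gamma a s' + curve_length gamma s' t'.
  have [E|na] := eqVneq a s'; first by rewrite -E curve_lengthxx add0r.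
  have at_ := le_lt_trans as_ st.
  apply: curve_length_cat; last by rewrite as_ ltW.
  exact: piecewise_C1S pC (lexx a) at_ tb.
by rewrite addrAC subrr add0r ger0_norm ?curve_length_ge0//; exact: geodesic_dist_le.
Qed.

(** Parametrization of an almost minimal curve proportionally to arc length.  The
    arc length need not be strictly increasing, so a parameter is chosen for each
    value; the choice may be discontinuous, but points with nearby values of the
    arc length are close. *)
Lemma lipschitz_path P Q (e : R) : 0 < e -> exists (p : R -> M) (K : R),
  [/\ p 0 = P, p 1 = Q, 0 <= K <= d P Q + e &
      forall s t, 0 <= s <= 1 -> 0 <= t <= 1 -> d (p s) (p t) <= K * `|s - t|].
Proof.
move=> e0; have [g [a [b [pC ga gb le]]]] := geodesic_dist_near_minimal P Q e0.
set L := curve_length g a b in le.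
have ab := ltW (piecewise_C1_lt pC).
have L0 : 0 <= L by exact: curve_length_ge0.
have /choice[p hp] : forall tau : R, exists t, 0 <= tau <= 1 ->
    a <= t <= b /\ curve_length g a t = tau * L.
  move=> tau; have [tau01|] := pselect (0 <= tau <= 1); last by exists 0.
  have /andP[t0 t1] := tau01.
  have [|t tab <-] := @IVT _ _ _ _ (tau * L) ab (curve_length_continuous pC).
    rewrite curve_lengthxx minEle maxEle L0 mulr_ge0//= -/L.
    by rewrite ler_piMl.
  by exists t => _; move: tab; rewrite in_itv.
have lip s t : 0 <= s <= 1 -> 0 <= t <= 1 -> d (g (p s)) (g (p t)) <= L * `|s - t|.
  move=> /hp[sab Es] /hp[tab Et].
  apply: le_trans (dist_on_curve pC sab tab) _.
  by rewrite Es Et -mulrBl normrM (ger0_norm L0) mulrC distrC.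
have i0 : 0 <= (0 : R) <= 1 by rewrite lexx ler01.
have i1 : 0 <= (1 : R) <= 1 by rewrite lexx ler01.
exists (g \o p), L; split=> //.
- apply/esym/geodesic_dist_eq0/le_anti; rewrite geodesic_dist_ge0 andbT -ga.
  have [p0 E0] := hp _ i0.
  apply: le_trans (dist_on_curve pC _ p0) _; first by rewrite lexx.
  by rewrite E0 curve_lengthxx mul0r subrr normr0.
- apply/esym/geodesic_dist_eq0/le_anti; rewrite geodesic_dist_ge0 andbT -gb.
  have [p1 E1] := hp _ i1.
  apply: le_trans (dist_on_curve pC _ p1) _; first by rewrite lexx ab.
  by rewrite E1 mul1r subrr normr0.
- by rewrite L0 ltW.
Qed.

End LengthSpace.

(** * The geodesic distance of a Riemannian product *)

Section ProductDistance.
Context {R : realType} {m n : nat}.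
Variables (M : riemannian_manifold R m) (N : riemannian_manifold R n).
Local Notation MxN := (riemannian_prod M N).
Local Notation dM := (geodesic_dist M).
Local Notation dN := (geodesic_dist N).
Local Notation dP := (geodesic_dist MxN).

Lemma chart_norm_prod (ij : chart_index MxN) (z w : 'rV[R]_(m + n)) :
  chart_cod (charts ij) z ->
  chart_norm ij z w ^+ 2 = chart_norm ij.1 (lsubmx z) (lsubmx w) ^+ 2 +
                           chart_norm ij.2 (rsubmx z) (rsubmx w) ^+ 2.
Proof. by move=> /[dup] cz [cl cr]; rewrite !chart_norm_sqr. Qed.

Lemma near_curve (sigma : R -> MxN) t (A : MxN -> Prop) : {for t, continuous sigma} ->
  (\forall r \near sigma t, A r) -> \forall s \near t, A (sigma s).
Proof. by move=> ct H; exact: (ct _ H). Qed.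

Lemma near_fst (p : MxN) (A : M -> Prop) :
  (\forall Q \near p.1, A Q) -> \forall r \near p, A r.1.
Proof. by move=> H; apply: (cvg_fst (F := nbhs p.1) (G := nbhs p.2) H). Qed.

Lemma near_snd (p : MxN) (A : N -> Prop) :
  (\forall Q \near p.2, A Q) -> \forall r \near p, A r.2.
Proof. by move=> H; apply: (cvg_snd (F := nbhs p.1) (G := nbhs p.2) H). Qed.

Lemma plane_cauchy_schwarz (a b x y : R) : 0 <= x -> 0 <= y ->
  a ^+ 2 + b ^+ 2 <= 1 -> a * x + b * y <= Num.sqrt (x ^+ 2 + y ^+ 2).
Proof.
move=> x0 y0 ab.
have [neg|pos] := lerP (a * x + b * y) 0; first exact: le_trans (sqrtr_ge0 _).
rewrite -(ger0_norm (ltW pos)) -sqrtr_sqr ler_sqrt ?addr_ge0 ?sqr_ge0//.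
have h : (a * x + b * y) ^+ 2 + (a * y - b * x) ^+ 2 =
   (a ^+ 2 + b ^+ 2) * (x ^+ 2 + y ^+ 2) by ring.
have h2 : 0 <= (a * y - b * x) ^+ 2 by exact: sqr_ge0.
have h3 : (a ^+ 2 + b ^+ 2) * (x ^+ 2 + y ^+ 2) <= 1 * (x ^+ 2 + y ^+ 2).
  by rewrite ler_wpM2r// addr_ge0 ?sqr_ge0.
lra.
Qed.

(** For unit (a, b), the function a d_M + b d_N is infinitesimally 1-Lipschitz, because
    a nu_1 + b nu_2 <= sqrt (nu_1 ^ 2 + nu_2 ^ 2) for the norms of the two
    components of a vector.  The pair (a, b) is chosen proportional to the two
    distances to be bounded. *)
Lemma product_dist_lower (p : MxN) (q : MxN) :
  Num.sqrt (dM p.1 q.1 ^+ 2 + dN p.2 q.2 ^+ 2) <= dP p q.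
Proof.
set x := dM p.1 q.1; set y := dN p.2 q.2; set s := Num.sqrt _.
have x0 : 0 <= x by exact: geodesic_dist_ge0.
have y0 : 0 <= y by exact: geodesic_dist_ge0.
have [s0|s0] := eqVneq s 0; first by rewrite s0 geodesic_dist_ge0.
have sp : 0 < s by rewrite lt_neqAle eq_sym s0 sqrtr_ge0.
have s2 : s ^+ 2 = x ^+ 2 + y ^+ 2 by rewrite sqr_sqrtr// addr_ge0 ?sqr_ge0.
pose a := x / s; pose b := y / s.
have a0 : 0 <= a by rewrite divr_ge0// ltW.
have b0 : 0 <= b by rewrite divr_ge0// ltW.
have ab1 : a ^+ 2 + b ^+ 2 = 1.
  by rewrite /a /b !expr_div_n -mulrDl -s2 divff// expf_neq0.
pose f (r : MxN) : R := a * dM p.1 r.1 + b * dN p.2 r.2.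
have <- : f q - f p = s.
  rewrite /f !geodesic_distxx !mulr0 addr0 subr0 /a /b -/x -/y.
  by rewrite ![_ / s * _]mulrAC -mulrDl -!expr2 -s2 expr2 mulfK.
apply: lipschitz_geodesic_dist => sigma t sC e e0; have [ct _ _] := sC.
(* This value gives (1 + eta) (v + e / 2) <= v + e for the speed v. *)
pose eta := e / (2 * (1 + speed sigma t + e)).
have sp0 := speed_ge0 sigma t.
have den : 0 < 2 * (1 + speed sigma t + e) by rewrite mulr_gt0//; lra.
have eta0 : 0 < eta by rewrite divr_gt0.
have it : chart_dom (charts (chart_at (sigma t))) (sigma t) by exact: chart_atP.
have [it1 it2] := it.
have n1 : \forall r \near sigma t, dM (sigma t).1 r.1 <= (1 + eta) *
   chart_norm (chart_at (sigma t)).1 (charts (chart_at (sigma t)).1 (sigma t).1)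
    (charts (chart_at (sigma t)).1 r.1 - charts (chart_at (sigma t)).1 (sigma t).1).
  by apply: filterS (near_fst (dist_chart_upper it1 eta0)) => r [].
have n2 : \forall r \near sigma t, dN (sigma t).2 r.2 <= (1 + eta) *
   chart_norm (chart_at (sigma t)).2 (charts (chart_at (sigma t)).2 (sigma t).2)
    (charts (chart_at (sigma t)).2 r.2 - charts (chart_at (sigma t)).2 (sigma t).2).
  by apply: filterS (near_snd (dist_chart_upper it2 eta0)) => r [].
have e2 : 0 < e / 2 by rewrite divr_gt0.
apply: filterS3 (near_curve ct n1) (near_curve ct n2) (chart_increment sC it e2) => u h1 h2 [_ h3].
have cz := chart_mapP it.
have := chart_norm_prod
  (charts (chart_at (sigma t)) (sigma u) - charts (chart_at (sigma t)) (sigma t)) cz.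
rewrite !linearB /= !row_mxKl !row_mxKr.
set nu1 := chart_norm _ _ _ in h1 *; set nu2 := chart_norm _ _ _ in h2 *.
set nu := chart_norm _ _ _ in h3 *; move=> nuE.
have le1 : `|f (sigma u) - f (sigma t)| <= a * dM (sigma t).1 (sigma u).1 +
    b * dN (sigma t).2 (sigma u).2.
  rewrite /f opprD addrACA -!mulrBr; apply: le_trans (ler_normD _ _) _.
  rewrite (normrM a) (normrM b) (ger0_norm a0) (ger0_norm b0) lerD// ler_wpM2l//.
    by rewrite (geodesic_dist_sym (sigma t).1) geodesic_dist_lipschitz.
  by rewrite (geodesic_dist_sym (sigma t).2) geodesic_dist_lipschitz.
apply: le_trans le1 _.
have nu10 : 0 <= nu1 by exact: sqrtr_ge0.
have nu20 : 0 <= nu2 by exact: sqrtr_ge0.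
have nu0 : 0 <= nu by exact: sqrtr_ge0.
have cs : a * nu1 + b * nu2 <= nu.
  rewrite -(ger0_norm nu0) -sqrtr_sqr nuE; apply: plane_cauchy_schwarz => //.
  by rewrite ab1.
have le2 : a * dM (sigma t).1 (sigma u).1 + b * dN (sigma t).2 (sigma u).2 <=
    (1 + eta) * nu.
  have g1 := ler_wpM2l a0 h1; have g2 := ler_wpM2l b0 h2.
  have g3 : (1 + eta) * (a * nu1 + b * nu2) <= (1 + eta) * nu.
    by rewrite ler_wpM2l//; lra.
  lra.
apply: le_trans le2 _.
have g4 : (1 + eta) * nu <= (1 + eta) * ((speed sigma t + e / 2) * `|u - t|).
  by rewrite ler_wpM2l//; lra.
apply: le_trans g4 _; rewrite mulrA ler_wpM2r//.
have : eta * (speed sigma t + e / 2) <= e / 2.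
  rewrite /eta mulrAC ler_pdivrMr//; nra.
lra.
Qed.

End ProductDistance.

Section ProductDistanceUpper.
Context {R : realType} {m n : nat}.
Variables (M : riemannian_manifold R m) (N : riemannian_manifold R n).
Local Notation MxN := (riemannian_prod M N).
Local Notation dM := (geodesic_dist M).
Local Notation dN := (geodesic_dist N).
Local Notation dP := (geodesic_dist MxN).

(** A straight segment in a product chart is bounded by its Pythagorean norm, and each
    component of that norm by the distance in the factor. *)
Lemma product_dist_near (r : MxN) (e : R) : 0 < e -> exists2 rho : R, 0 < rho &
  forall r' : MxN, dM r.1 r'.1 < rho -> dN r.2 r'.2 < rho ->
    dP r r' <= (1 + e) ^+ 2 * Num.sqrt (dM r.1 r'.1 ^+ 2 + dN r.2 r'.2 ^+ 2).
Proof.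
move=> e0; pose ij := chart_at r.
have ir : chart_dom (charts ij) r by exact: chart_atP.
have [i1 i2] := ir; set x := charts ij r.
have cx := chart_mapP ir.
have /nbhs_ballP[d d0' hd] := dist_chart_coord_upper cx e0.
have d0 : 0 < d := d0'.
have [rho1 rho10 h1] := dist_chart_lower i1 e0 d0.
have [rho2 rho20 h2] := dist_chart_lower i2 e0 d0.
exists (Num.min rho1 rho2) => [|r']; first by rewrite lt_min rho10.
rewrite !lt_min => /andP[d1 _] /andP[_ d2].
have [j1 l1 n1] := h1 _ d1; have [j2 l2 n2] := h2 _ d2.
have jr : chart_dom (charts ij) r' by [].
have xb : ball x d (charts ij r').
  split=> // k l; rewrite -ball_normE /= !mxE -normrN opprB.
  case: (fintype.split l) => l'.
    apply: le_lt_trans l1; apply: le_trans (coord_le_norm _ k l').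
    by rewrite !mxE.
  apply: le_lt_trans l2; apply: le_trans (coord_le_norm _ k l').
  by rewrite !mxE.
have [_ _] := hd _ xb; rewrite !chart_mapK// => /le_trans; apply.
rewrite exprS expr1 -mulrA ler_pM2l; last lra.
have e10 : 0 <= 1 + e by lra.
set A := dM _ _ in n1 *; set B := dN _ _ in n2 *.
have A0 : 0 <= A by exact: geodesic_dist_ge0.
have B0 : 0 <= B by exact: geodesic_dist_ge0.
rewrite -(ger0_norm e10) -{1}sqrtr_sqr -sqrtrM ?sqr_ge0//.
have nu0 := chart_norm_ge0 ij x (charts ij r' - x).
rewrite -(ger0_norm nu0) -sqrtr_sqr ler_sqrt; last first.
  by rewrite mulr_ge0 ?addr_ge0 ?sqr_ge0.
rewrite chart_norm_prod// !linearB /= !row_mxKl !row_mxKr mulrDr -!exprMn.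
by apply: lerD; rewrite ler_pXn2r ?nnegrE ?mulr_ge0 ?sqrtr_ge0.
Qed.

(** The distance to the origin of the path (p, q) has increments locally bounded by
    [product_dist_near], so its growth rate is at most the constant claimed. *)
Lemma product_dist_lipschitz (p : R -> M) (q : R -> N) (K1 K2 e : R) :
  0 <= K1 -> 0 <= K2 -> 0 < e ->
  (forall s t, 0 <= s <= 1 -> 0 <= t <= 1 -> dM (p s) (p t) <= K1 * `|s - t|) ->
  (forall s t, 0 <= s <= 1 -> 0 <= t <= 1 -> dN (q s) (q t) <= K2 * `|s - t|) ->
  dP (p 0, q 0) (p 1, q 1) <= (1 + e) ^+ 2 * Num.sqrt (K1 ^+ 2 + K2 ^+ 2).
Proof.
move=> K10 K20 e0 lp lq; set K := _ * _.
pose G (t : R) : MxN := (p t, q t).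
pose F t := dP (G 0) (G t) - K * t.
suff : F 1 <= F 0 by rewrite /F geodesic_distxx mulr0 subr0 mulr1 subr_le0.
apply: dini_nonincreasing => // t t01 eta eta0.
have [rho rho0 hr] := product_dist_near (G t) e0.
have C0 : 0 < K1 + K2 + 1 by lra.
apply/nbhs_ballP; exists (rho / (K1 + K2 + 1)) => /=; first by rewrite divr_gt0.
move=> s; rewrite -ball_normE/= ltr_pdivlMr// => ts s01.
have n0 : 0 <= `|t - s| by [].
have b1 : dM (p t) (p s) <= K1 * `|t - s| by exact: lp.
have b2 : dN (q t) (q s) <= K2 * `|t - s| by exact: lq.
have GG : dP (G t) (G s) <= K * `|t - s|.
  have H : dP (G t) (G s) <=
      (1 + e) ^+ 2 * Num.sqrt (dM (p t) (p s) ^+ 2 + dN (q t) (q s) ^+ 2).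
    by apply: hr => /=; [apply: le_lt_trans b1 _|apply: le_lt_trans b2 _]; nra.
  apply: le_trans H _; rewrite /K -mulrA ler_pM2l; last by rewrite exprn_gt0; lra.
  rewrite -[X in _ <= _ * X](ger0_norm n0) -sqrtr_sqr -sqrtrM ?addr_ge0 ?sqr_ge0//.
  rewrite ler_sqrt; last by rewrite mulr_ge0 ?addr_ge0 ?sqr_ge0.
  rewrite mulrDl -!exprMn.
  by apply: lerD; rewrite ler_pXn2r ?nnegrE ?mulr_ge0 ?geodesic_dist_ge0.
have := le_trans (geodesic_dist_lipschitz (G 0) (G t) (G s)) GG.
rewrite ler_norml /F => /andP[g1 g2].
split=> [le_ts|le_st].
  have E : `|t - s| = s - t by rewrite distrC ger0_norm ?subr_ge0.
  have : 0 <= eta * (s - t) by rewrite mulr_ge0 ?subr_ge0// ltW.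
  rewrite E in g1 g2; lra.
have E : `|t - s| = t - s by rewrite ger0_norm ?subr_ge0.
have : 0 <= eta * (t - s) by rewrite mulr_ge0 ?subr_ge0// ltW.
rewrite E in g1 g2; lra.
Qed.

(** The Pythagorean formula.  The upper bound is the limit e -> 0 of
    [product_dist_lipschitz] for e-minimal paths of both factors. *)
Lemma product_dist (p q : MxN) :
  dP p q = Num.sqrt (dM p.1 q.1 ^+ 2 + dN p.2 q.2 ^+ 2).
Proof.
apply: le_anti; rewrite product_dist_lower andbT.
set x := dM _ _; set y := dN _ _; set s := Num.sqrt _.
have s0 : 0 <= s by exact: sqrtr_ge0.
have x0 : 0 <= x by exact: geodesic_dist_ge0.
have y0 : 0 <= y by exact: geodesic_dist_ge0.
have s2 : s ^+ 2 = x ^+ 2 + y ^+ 2 by rewrite sqr_sqrtr// addr_ge0 ?sqr_ge0.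
(* For e <= 1, (1 + e)^2 (s + 2 e) <= (1 + 3 e) (s + 2 e) <= s + (8 + 3 s) e. *)
have main e : 0 < e -> e <= 1 -> dP p q <= s + (8 + 3 * s) * e.
  move=> e0 e1.
  have [f [K1 [f0 f1 /andP[K10 K1e] lf]]] := lipschitz_path p.1 q.1 e0.
  have [g [K2 [g0 g1 /andP[K20 K2e] lg]]] := lipschitz_path p.2 q.2 e0.
  have := product_dist_lipschitz K10 K20 e0 lf lg.
  rewrite f0 f1 g0 g1 -!surjective_pairing => /le_trans; apply.
  have : Num.sqrt (K1 ^+ 2 + K2 ^+ 2) <= s + 2 * e.
    have se0 : 0 <= s + 2 * e by rewrite addr_ge0// mulr_ge0// ltW.
    rewrite -(ger0_norm se0) -sqrtr_sqr ler_sqrt ?sqr_ge0//.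
    have xs : x <= s.
      by rewrite -(@ler_pXn2r _ 2)// s2 lerDl sqr_ge0.
    have ys : y <= s.
      by rewrite -(@ler_pXn2r _ 2)// s2 lerDr sqr_ge0.
    have k1 : K1 ^+ 2 <= (x + e) ^+ 2 by rewrite ler_pXn2r ?nnegrE//; lra.
    have k2 : K2 ^+ 2 <= (y + e) ^+ 2 by rewrite ler_pXn2r ?nnegrE//; lra.
    nra.
  set k := Num.sqrt _ => ks.
  have k0 : 0 <= k by exact: sqrtr_ge0.
  have h1 : (1 + e) ^+ 2 <= 1 + 3 * e by nra.
  apply: (@le_trans _ _ ((1 + 3 * e) * (s + 2 * e))).
    by apply: ler_pM => //; exact: sqr_ge0.
  nra.
apply/ler_addgt0Pr => e e0; pose C := 8 + 3 * s.
have C0 : 0 < C by rewrite /C; lra.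
pose e' := Num.min 1 (e / C).
have e'0 : 0 < e' by rewrite lt_min ltr01 divr_gt0.
have e'1 : e' <= 1 by rewrite ge_min lexx.
have := main e' e'0 e'1; rewrite -/C => /le_trans; apply.
by rewrite lerD2l mulrC -ler_pdivlMr// ge_min lexx orbT.
Qed.

End ProductDistanceUpper.

(** * Minimal closed geodesics are circles *)

Section CurvePoints.
Context {R : realType} {n : nat} (M : riemannian_manifold R n).
Implicit Types (gamma sigma : R -> M) (a b c e s t : R) (P Q : M).
Local Notation d := (geodesic_dist M).

Lemma piecewise_C1_compact gamma a b : piecewise_C1 gamma a b ->
  compact (gamma @` `[a, b]).
Proof.
elim=> [{}a {}b ab [sigma gs sC]|{}a {}b c' ab IHab bc IHbc].
  have -> : gamma @` `[a, b] = sigma @` `[a, b].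
    by apply/seteqP; split=> _ [t tab <-]; exists t => //; rewrite gs.
  apply: continuous_compact; last exact: segment_compact.
  by apply: continuous_in_subspaceT => t; rewrite inE => /sC[].
have -> : gamma @` `[a, c'] = gamma @` `[a, b] `|` gamma @` `[b, c'].
  rewrite -image_setU; congr (gamma @` _); rewrite eqEsubset; split=> t /=.
    rewrite !in_itv/= => /andP[at_ tc].
    by have [tb|/ltW bt] := leP t b; [left; rewrite at_|right; rewrite bt tc].
  have ltab := ltW (piecewise_C1_lt ab); have ltbc := ltW (piecewise_C1_lt bc).
  rewrite !in_itv/= => -[/andP[at_ tb]|/andP[bt tc]]; apply/andP; split=> //.
    exact: le_trans tb ltbc.
  exact: le_trans ltab bt.
exact: compactU.
Qed.

Lemma piecewise_C1_closed gamma a b s t : piecewise_C1 gamma a b ->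
  a <= s -> t <= b -> closed (gamma @` `[s, t]).
Proof.
move=> pC as_ tb; apply: compact_closed; first exact: manifold_hausdorff.
have [st|ts|<-] := ltgtP s t.
- by apply: piecewise_C1_compact; exact: piecewise_C1S pC as_ st tb.
- by rewrite set_itv_ge ?bnd_simp -?ltNge// image_set0; exact: compact0.
- by rewrite set_itv1 image_set1; exact: compact_set1.
Qed.

Lemma dist_continuous_on_curve gamma a b P : piecewise_C1 gamma a b ->
  {within `[a, b], continuous (fun t => d P (gamma t))}.
Proof.
move=> pC; have /subspace_continuousP cG := curve_length_continuous pC.
apply/subspace_continuousP => t tab.
apply/cvgrPdist_le => /= e e0.
have /cvgrPdist_le/(_ e e0) := cG t tab.
rewrite !near_withinE; apply: filterS => s hs sab; have := hs sab; apply: le_trans.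
apply: le_trans (geodesic_dist_lipschitz _ _ _) _.
rewrite distrC; apply: (dist_on_curve pC).
  by move: tab; rewrite /= in_itv.
by move: sab; rewrite /= in_itv.
Qed.

Lemma dist_on_curve_IVT gamma a b s t P (v : R) : piecewise_C1 gamma a b ->
  a <= s -> s <= t -> t <= b ->
  Num.min (d P (gamma s)) (d P (gamma t)) <= v <=
  Num.max (d P (gamma s)) (d P (gamma t)) ->
  exists2 r, s <= r <= t & d P (gamma r) = v.
Proof.
move=> pC as_ st tb hv.
have sub : `[s, t] `<=` `[a, b] by apply: subset_itv; rewrite bnd_simp.
have cf := continuous_subspaceW sub (dist_continuous_on_curve (P := P) pC).
have [r rst rv] := IVT st cf hv.
by exists r => //; move: rst; rewrite in_itv.
Qed.

(** Each part of a minimal path is minimal, since lengths add up to the distance. *)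
Lemma minimal_geodesic_split sigma c e P Q u : minimal_geodesic sigma c e P Q ->
  c <= u <= e -> d P Q = d P (sigma u) + d (sigma u) Q.
Proof.
move=> [ce geo sc se len] /andP[cu ue].
have sC : C1_curve sigma c e by move=> t tce; have [] := geo t tce.
have pC := C1_curve_piecewise ce sC.
have c1 : c <= c <= e by rewrite lexx ltW.
have c2 : c <= u <= e by rewrite cu.
have c3 : c <= e <= e by rewrite lexx ltW.
have l1 := dist_on_curve pC c1 c2; have l2 := dist_on_curve pC c2 c3.
have cat := C1_curve_length_cat sC c2.
have L1 := curve_length_ge0 sigma c u; have L2 := curve_length_ge0 sigma u e.
rewrite curve_lengthxx subr0 ger0_norm// in l1.
rewrite cat addrAC subrr add0r ger0_norm// in l2.
rewrite sc in l1; rewrite se in l2.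
apply: le_anti; rewrite geodesic_dist_triangle/= -len cat.
exact: lerD.
Qed.

(** The times spent in [A] and in [B] are closed sets that cover an interval; by
    connectedness they have a common point. *)
Lemma minimal_geodesic_crossing sigma c e P Q (A B : set M) :
  minimal_geodesic sigma c e P Q -> closed A -> closed B ->
  sigma @` `[c, e] `<=` A `|` B -> A P -> B Q ->
  exists Z, [/\ A Z, B Z & d P Q = d P Z + d Z Q].
Proof.
move=> mg cA cB sAB AP BQ; have [ce geo sc se _] := mg.
have cl D : closed D -> closed (`[c, e] `&` sigma @^-1` D).
  move=> cD t /= clt.
  have tce : `[c, e]%classic t.
    have : closed `[c, e]%classic by exact: itv_closed.
    by apply=> V /clt[s [[sce _] Vs]]; exists s.
  split=> //; apply: cD => V Vt.
  have [[ct _ _] _] := geo t tce.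
  by have [s [[_ Ds] Vs]] := clt _ (ct _ Vt); exists (sigma s).
apply: contrapT => nex.
have dis t : `[c, e]%classic t -> A (sigma t) -> B (sigma t) -> False.
  move=> tce At Bt; apply: nex; exists (sigma t); split=> //.
  by apply: (minimal_geodesic_split mg); move: tce; rewrite /= in_itv.
have := @segment_connected _ c e.
move=> /(_ (`[c, e] `&` sigma @^-1` A)) H.
have cce : `[c, e]%classic c by rewrite /= in_itv/= lexx ltW.
have ece : `[c, e]%classic e by rewrite /= in_itv/= lexx ltW.
have /seteqP[_ /(_ e ece)[_ Ae]] : `[c, e] `&` sigma @^-1` A = `[c, e]%classic.
  apply: H.
  - by exists c; split=> //=; rewrite sc.
  - exists (~` (`[c, e] `&` sigma @^-1` B)); first exact/closed_openC/cl.
    apply/seteqP; split=> t [tce ht]; split=> //.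
      by move=> [_ Bt]; exact: dis tce ht Bt.
    have [//|Bt] : (A `|` B) (sigma t) by apply: sAB; exists t.
    by case: ht.
  - exists (`[c, e] `&` sigma @^-1` A); first exact: cl.
    by rewrite setIA setIid.
by apply: (dis e ece) => //; rewrite se.
Qed.

End CurvePoints.

Section MinimalClosedGeodesic.
Context {R : realType} {n : nat} (M : riemannian_manifold R n).
Variables (gamma : R -> M) (a b : R).
Hypothesis mcg : minimal_closed_geodesic M gamma a b.
Local Notation d := (geodesic_dist M).

Let pC : piecewise_C1 gamma a b. Proof. by case: mcg. Qed.
Let gab : gamma a = gamma b. Proof. by case: mcg. Qed.
Let inj : {in `[a, b[ &, injective gamma}. Proof. by case: mcg. Qed.
Let ab : a < b. Proof. exact: piecewise_C1_lt pC. Qed.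

Let injE r r' : a <= r <= b -> a <= r' <= b -> gamma r = gamma r' ->
  [\/ r = r', r = b | r = a /\ r' = b].
Proof.
move=> /andP[ar rb] /andP[ar' rb'] E.
have [->|rnb] := eqVneq r b; first by apply: Or32.
have rb1 : r < b by rewrite lt_neqAle rnb.
have [r'b|r'nb] := eqVneq r' b.
  apply: Or33; split=> //; apply: inj; rewrite ?in_itv/= ?ar ?lexx//.
  by rewrite E r'b gab.
apply: Or31; apply: inj; rewrite ?in_itv/= ?ar ?ar'//.
by rewrite lt_neqAle r'nb.
Qed.

(** The arc from s to t and its complementary arc are closed, cover the curve, and
    meet only at their ends because the curve is simple: the minimal path from a
    point of one to a point of the other visits one of the ends. *)
Lemma closed_geodesic_separation s t y x : a <= s -> s <= y -> y <= t -> t <= b ->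
  a <= x <= s \/ t <= x <= b ->
  d (gamma y) (gamma x) = d (gamma y) (gamma s) + d (gamma s) (gamma x) \/
  d (gamma y) (gamma x) = d (gamma y) (gamma t) + d (gamma t) (gamma x).
Proof.
move=> as_ sy yt tb hx.
have st := le_trans sy yt.
have onC r : a <= r <= b -> (gamma @` `[a, b]) (gamma r).
  by move=> rab; exists r => //=; rewrite in_itv.
have [_ _ _ seg] := mcg.
have xab : a <= x <= b.
  by case: hx => /andP[x1 x2]; apply/andP; split=> //;
    [apply: le_trans x2 _; apply: le_trans tb|apply: le_trans x1; apply: le_trans st].
have yab : a <= y <= b by rewrite (le_trans as_ sy) (le_trans yt tb).
have [sigma [c [e [mg sub]]]] := seg _ _ (onC _ yab) (onC _ xab).
pose A := gamma @` `[s, t]; pose B := gamma @` `[a, s] `|` gamma @` `[t, b].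
have cA : closed A by exact: piecewise_C1_closed pC _ _.
have cB : closed B.
  apply: closedU; apply: (piecewise_C1_closed pC) => //; first exact: le_trans st tb.
  exact: le_trans as_ st.
have [Z [[r rst <-] BZ dZ]] : exists Z, [/\ A Z, B Z &
    d (gamma y) (gamma x) = d (gamma y) Z + d Z (gamma x)].
  apply: minimal_geodesic_crossing mg cA cB _ _ _.
  - move=> _ /sub[r rab <-]; move: rab; rewrite /= in_itv/= => /andP[ar rb].
    have [rs|/ltW sr] := leP r s; first by right; left; exists r => //=; rewrite in_itv/= ar.
    have [rt|/ltW tr] := leP r t; first by left; exists r => //=; rewrite in_itv/= sr.
    by right; right; exists r => //=; rewrite in_itv/= tr.
  - by exists y => //=; rewrite in_itv/= sy.
  - by case: hx => hx; [left|right]; exists x => //=; rewrite in_itv.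
move: rst; rewrite /= in_itv/= => /andP[sr rt].
suff [E|E] : gamma r = gamma s \/ gamma r = gamma t.
- by left; rewrite -E.
- by right; rewrite -E.
have rab : a <= r <= b by rewrite (le_trans as_ sr) (le_trans rt tb).
have [r' r'st E] : exists2 r', a <= r' <= s \/ t <= r' <= b & gamma r' = gamma r.
  by case: BZ => -[r' + E]; rewrite /= in_itv/= => hr'; exists r' => //; [left|right].
have r'ab : a <= r' <= b.
  by case: r'st => /andP[x1 x2]; apply/andP; split=> //;
    [apply: le_trans x2 _; apply: le_trans tb|apply: le_trans x1; apply: le_trans st].
case: (injE rab r'ab (esym E)) => [rr'|rb|[ra _]].
- rewrite -rr' in r'st; case: r'st => /andP[h1 h2]; [left|right]; congr gamma.
    by apply: le_anti; rewrite h2 sr.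
  by apply: le_anti; rewrite h1 rt.
- by right; congr gamma; apply: le_anti; rewrite rt rb tb.
- by left; congr gamma; apply: le_anti; rewrite sr ra as_.
Qed.

(** [P] is the base point of the curve and [Q] a point farthest from it. *)
Lemma closed_geodesic_antipodes : exists P Q, 0 < d P Q /\
  forall h, 0 <= h <= d P Q -> exists X Y,
    [/\ d P X = h, d Q Y = h, d P Y = d P Q - h, d X Q = d P Q - h & d X Y = d P Q].
Proof.
pose P := gamma a.
have cu := dist_continuous_on_curve (P := P) pC.
have [t0 t0ab maxu] := EVT_max (ltW ab) cu.
move: t0ab; rewrite in_itv/= => /andP[at0 t0b].
pose Q := gamma t0; pose L := d P Q.
have uL t : a <= t <= b -> d P (gamma t) <= L.
  by move=> tab; apply: maxu; rewrite in_itv.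
have L0 : 0 < L.
  pose c := (a + b) / 2.
  have ac : a < c by rewrite (midf_lt ab).
  have cb : c < b by rewrite (midf_lt ab).
  apply: lt_le_trans (uL c _); last by rewrite !ltW.
  rewrite lt_neqAle geodesic_dist_ge0 andbT eq_sym; apply/eqP => /geodesic_dist_eq0 E.
  have : a = c by apply: inj; rewrite ?in_itv/= ?lexx ?(ltW ac)//.
  by move=> E'; rewrite -E' ltxx in ac.
have at0' : a < t0.
  rewrite lt_neqAle at0 andbT; apply/eqP => E.
  by move: L0; rewrite /L /Q -E geodesic_distxx ltxx.
have t0b' : t0 < b.
  rewrite lt_neqAle t0b andbT; apply/eqP => E.
  by move: L0; rewrite /L /Q E -gab geodesic_distxx ltxx.
have neQ y : a <= y <= b -> y != t0 -> 0 < d (gamma y) Q.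
  move=> yab yt0; rewrite lt_neqAle geodesic_dist_ge0 andbT eq_sym.
  apply/eqP => /geodesic_dist_eq0 E.
  have t0ab : a <= t0 <= b by rewrite at0.
  case: (injE yab t0ab E) => [yt|yb|[_ t0b2]].
  - by rewrite yt eqxx in yt0.
  - move: L0; rewrite /L /Q -[gamma t0]E yb -gab geodesic_distxx.
    by rewrite ltxx.
  - by rewrite t0b2 ltxx in t0b'.
(* On each arc the distance to [P] increases towards [Q], and its increments are
   the distances between points. *)
have arc1 w y : a <= w -> w <= y -> y < t0 ->
    d P (gamma y) = d P (gamma w) + d (gamma w) (gamma y).
  move=> aw wy yt0.
  have yab : a <= y <= b by rewrite (le_trans aw wy) (le_trans (ltW yt0)).
  have hx : a <= a <= w \/ t0 <= a <= b by left; rewrite lexx.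
  have [H|H] := closed_geodesic_separation aw wy (ltW yt0) t0b hx.
    by rewrite geodesic_dist_sym H addrC !(geodesic_dist_sym (gamma w)).
  have := neQ y yab; rewrite lt_eqF// => /(_ isT).
  have := uL y yab; rewrite geodesic_dist_sym H (geodesic_dist_sym _ (gamma a)) -/P -/Q -/L.
  lra.
have arc2 w y : t0 < y -> y <= w -> w <= b ->
    d P (gamma y) = d P (gamma w) + d (gamma w) (gamma y).
  move=> t0y yw wb.
  have yab : a <= y <= b by rewrite (le_trans yw wb) (le_trans at0 (ltW t0y)).
  have hx : a <= b <= t0 \/ w <= b <= b by right; rewrite lexx wb.
  have [H|H] := closed_geodesic_separation at0 (ltW t0y) yw wb hx; rewrite -gab in H.
    have := neQ y yab; rewrite gt_eqF// => /(_ isT).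
    have := uL y yab; rewrite geodesic_dist_sym H (geodesic_dist_sym _ (gamma a)) -/P -/Q -/L.
    lra.
  by rewrite geodesic_dist_sym H addrC !(geodesic_dist_sym (gamma w)).
have Q0 : d Q Q = 0 by exact: geodesic_distxx.
(* Each point of the curve lies on a metric segment from [P] to [Q]: compare with
   points [gamma y] of the same arc at distance [v] from [Q], where [v] is
   arbitrarily small. *)
have seg w : a <= w <= b -> d (gamma w) Q = L - d P (gamma w).
  move=> wab; have /andP[aw wb] := wab.
  have tri := geodesic_dist_triangle (gamma w) P Q; rewrite -/L in tri.
  suff H : d (gamma w) Q <= L - d P (gamma w) by apply: le_anti; rewrite H; lra.
  have [wt0|t0w|->] := ltgtP w t0; last by rewrite -/Q -/L Q0 subrr.
    apply/ler_addgt0Pr => e e0.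
    have pos := neQ w wab; rewrite lt_eqF// in pos; have {}pos := pos isT.
    pose v := Num.min e (d (gamma w) Q).
    have v0 : 0 < v by rewrite lt_min e0.
    have ve : v <= e by rewrite ge_min lexx.
    have vd : v <= d Q (gamma w) by rewrite geodesic_dist_sym ge_min lexx orbT.
    have [|y /andP[wy yt0] vy] := dist_on_curve_IVT (v := v) (P := Q) pC aw (ltW wt0) t0b.
      rewrite -/Q Q0 ge_min (ltW v0) orbT/= le_max vd//.
    have yt0' : y < t0.
      rewrite lt_neqAle yt0 andbT; apply/eqP => E.
      by move: v0; rewrite -vy E -/Q Q0 ltxx.
    have yab : a <= y <= b by rewrite (le_trans aw wy) (le_trans yt0).
    have h1 := arc1 w y aw wy yt0'; have h2 := uL y yab.
    have h3 := geodesic_dist_triangle (gamma y) (gamma w) Q.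
    rewrite (geodesic_dist_sym (gamma y) Q) vy in h3.
    lra.
  apply/ler_addgt0Pr => e e0.
  have pos := neQ w wab; rewrite gt_eqF// in pos; have {}pos := pos isT.
  pose v := Num.min e (d (gamma w) Q).
  have v0 : 0 < v by rewrite lt_min e0.
  have ve : v <= e by rewrite ge_min lexx.
  have vd : v <= d Q (gamma w) by rewrite geodesic_dist_sym ge_min lexx orbT.
  have [|y /andP[t0y yw] vy] := dist_on_curve_IVT (v := v) (P := Q) pC at0 (ltW t0w) wb.
    rewrite -/Q Q0 ge_min (ltW v0)/= le_max vd orbT//.
  have t0y' : t0 < y.
    rewrite lt_neqAle t0y andbT; apply/eqP => E.
    by move: v0; rewrite -vy -E -/Q Q0 ltxx.
  have yab : a <= y <= b by rewrite (le_trans yw wb) (le_trans at0 t0y).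
  have h1 := arc2 w y t0y' yw wb; have h2 := uL y yab.
  have h3 := geodesic_dist_triangle (gamma y) (gamma w) Q.
  rewrite (geodesic_dist_sym (gamma y) Q) vy in h3.
  lra.
exists P, Q; split; first exact: L0.
move=> h /andP[h0 hL]; rewrite -/L in hL *.
have P0 : d P P = 0 by exact: geodesic_distxx.
have [|x /andP[ax xt0] ux] := dist_on_curve_IVT (v := h) (P := P) pC (lexx a) at0 t0b.
  by rewrite -/P P0 ge_min h0 le_max -/Q -/L hL orbT.
have [|y /andP[t0y yb] uy] := dist_on_curve_IVT (v := L - h) (P := P) pC at0 t0b (lexx b).
  rewrite -gab -/P P0 ge_min le_max subr_ge0 hL orbT -/Q -/L/=.
  by apply/orP; left; lra.
have xab : a <= x <= b by rewrite ax (le_trans xt0 t0b).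
have yab : a <= y <= b by rewrite yb (le_trans at0 t0y).
have sx := seg x xab; have sy := seg y yab; rewrite ux in sx; rewrite uy in sy.
have QY : d Q (gamma y) = h by rewrite geodesic_dist_sym sy; lra.
exists (gamma x), (gamma y); split=> //.
have hx : a <= y <= a \/ t0 <= y <= b by right; rewrite t0y.
(* Both ways around, from [X] to [Y] through [P] or through [Q], have length [L]. *)
have [->|->] := closed_geodesic_separation (lexx a) ax xt0 t0b hx.
  rewrite (geodesic_dist_sym (gamma x)) -/P ux uy; lra.
rewrite -/Q sx QY; lra.
Qed.

End MinimalClosedGeodesic.

(** * Energy of an array of dipoles *)

Section Powers.
Context {R : realType}.
Implicit Types (a h x y z H : R).

(** Young's inequality for [z `^ H] and 1, with exponents 1 / H and 1 / (1 - H). *)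
Lemma powR_bernoulli z H : 0 <= z -> 0 < H < 1 -> z `^ H <= 1 + H * (z - 1).
Proof.
move=> z0 /andP[H0 H1].
have H1' : 0 < 1 - H by lra.
have := @conjugate_powR _ (z `^ H) 1 H^-1 (1 - H)^-1 (powR_ge0 _ _) ler01.
rewrite !invr_gt0 !invrK => /(_ H0 H1'); rewrite addrC subrK => /(_ erefl).
rewrite mulr1 -powRrM divff ?gt_eqF// powRr1// powR1; lra.
Qed.

Lemma powR_ge1 x H : 1 <= x -> 0 <= H -> 1 <= x `^ H.
Proof. by move=> x1 H0; have := ler_powR x1 H0; rewrite powRr0. Qed.

Lemma sqr_powR x H : 0 <= x -> (x ^+ 2) `^ H = x `^ (2 * H).
Proof. by move=> x0; rewrite powRrM powR_mulrn. Qed.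

Lemma sqrt_powR x H : 0 <= x -> (Num.sqrt x) `^ (2 * H) = x `^ H.
Proof. by move=> x0; rewrite -sqr_powR ?sqrtr_ge0// sqr_sqrtr. Qed.

(** Each share z / (x + y) is less than 1, hence exceeds its power [p]. *)
Lemma powR_superadditive x y p : 0 < x -> 0 < y -> 1 < p ->
  x `^ p + y `^ p < (x + y) `^ p.
Proof.
move=> x0 y0 p1; have s0 : 0 < x + y by exact: addr_gt0.
have lt z : 0 < z -> z < x + y -> z `^ p < z / (x + y) * (x + y) `^ p.
  move=> z0 zs; have t0 : 0 < z / (x + y) by exact: divr_gt0.
  have t1 : z / (x + y) < 1 by rewrite ltr_pdivrMr// mul1r.
  rewrite -{1}(divfK (lt0r_neq0 s0) z) powRM ?(ltW t0) ?(ltW s0)//.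
  rewrite ltr_pM2r ?powR_gt0// -mulr_powRB1 ?(ltW t0)//; last lra.
  rewrite gtr_pMr//.
  have p10 : 0 < p - 1 by rewrite subr_gt0.
  have := gt0_ltr_powR p10 (x := z / (x + y)) (y := 1); rewrite powR1.
  by apply; rewrite ?nnegrE ?(ltW t0).
have := ltrD (lt x x0 _) (lt y y0 _); rewrite -mulrDl -mulrDl divff ?gt_eqF// mul1r.
by apply; rewrite ?ltrDl ?ltrDr.
Qed.

(** Bernoulli's inequality at B / A. *)
Lemma powR_sub_lower A B H : 0 < A -> 0 <= B -> 0 < H < 1 ->
  H * (A - B) * (A `^ H / A) <= A `^ H - B `^ H.
Proof.
move=> A0 B0 H01.
have Ap : 0 < A `^ H by exact: powR_gt0.
have := powR_bernoulli (divr_ge0 B0 (ltW A0)) H01.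
rewrite -(ler_pM2l Ap) -powRM ?(ltW A0) ?divr_ge0// ?(ltW A0)//.
rewrite [A * _]mulrC divfK ?gt_eqF// => h.
have -> : H * (A - B) * (A `^ H / A) = A `^ H - A `^ H * (1 + H * (B / A - 1)).
  by field; rewrite gt_eqF.
by rewrite lerD2l lerN2.
Qed.

(** With r = h x, Bernoulli's inequality leaves (h ^ 2) ^ H times
    H x ^ (2 H - 2), and x ^ (2 H) <= x as 2 H <= 1 <= x. *)
Lemma powR_sub_upper h r j H : 0 < h -> 1 <= j -> j * h <= r -> 0 < H -> H <= 2^-1 ->
  (h ^+ 2 + r ^+ 2) `^ H - (r ^+ 2) `^ H <= (h ^+ 2) `^ H * (H / j).
Proof.
move=> h0 j1 jr H0 H12.
have H01 : 0 < H < 1 by apply/andP; split; lra.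
pose x := r / h.
have rE : r = h * x by rewrite /x mulrC divfK// gt_eqF.
have xj : j <= x by rewrite ler_pdivlMr.
have x1 : 1 <= x by exact: le_trans xj.
have x0 : 0 < x by lra.
have h20 : 0 <= h ^+ 2 by exact: sqr_ge0.
have -> : h ^+ 2 + r ^+ 2 = h ^+ 2 * (x ^+ 2 * (1 + x ^- 2)).
  by rewrite rE; field; rewrite gt_eqF.
have -> : r ^+ 2 = h ^+ 2 * x ^+ 2 by rewrite rE exprMn.
have ix0 : 0 <= x ^- 2 by rewrite invr_ge0 sqr_ge0.
have x20 : 0 <= x ^+ 2 by exact: sqr_ge0.
have u0 : 0 <= 1 + x ^- 2 by rewrite addr_ge0.
rewrite (powRM H h20 x20) (powRM H h20 (mulr_ge0 x20 u0)) (powRM H x20 u0).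
rewrite -mulrBr ler_pM2l ?powR_gt0 ?exprn_gt0//.
have bern := powR_bernoulli (addr_ge0 ler01 ix0) H01.
have xH : (x ^+ 2) `^ H <= x.
  by rewrite sqr_powR ?(ltW x0)//; apply: ler1_powR => //; lra.
have xH0 : 0 <= (x ^+ 2) `^ H by exact: powR_ge0.
apply: (@le_trans _ _ (x * (H * x ^- 2))).
  apply: (@le_trans _ _ ((x ^+ 2) `^ H * (H * x ^- 2))).
    rewrite -{2}[(x ^+ 2) `^ H]mulr1 -mulrBr ler_wpM2l//; lra.
  by rewrite ler_wpM2r// mulr_ge0// ltW.
have -> : x * (H * x ^- 2) = H / x by field; rewrite gt_eqF.
by rewrite ler_pM2l// lef_pV2 ?posrE//; lra.
Qed.

(** A telescoping bound: by Bernoulli's inequality, the increment of p ^ H at p is at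
    least H / (p + 1).  The sharp bound is logarithmic; any power of [p] less than the
    2 H gained from the size of the dipole suffices for the energy estimate. *)
Lemma harmonic_powR H p : 0 < H < 1 ->
  \sum_(0 <= i < p) H / i.+1%:R <= p%:R `^ H.
Proof.
move=> H01; elim: p => [|p IH]; first by rewrite big_nil powR_ge0.
rewrite big_nat_recr//=; apply: le_trans (lerD IH (lexx _)) _.
have p0 : 0 < p.+1%:R :> R by [].
have := powR_sub_lower p0 (ler0n R p) H01.
have -> : p.+1%:R - p%:R = 1 :> R by rewrite -addn1 natrD addrAC subrr add0r.
have T1 : 1 <= p.+1%:R `^ H.
  by apply: powR_ge1; rewrite ?ler1n//; case/andP: H01 => /ltW.
have /andP[H0 _] := H01.
have : H / p.+1%:R <= H * 1 * (p.+1%:R `^ H / p.+1%:R).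
  by rewrite mulr1 ler_pM2l// ler_pdivlMr// mulVf ?gt_eqF.
by move=> le1 le2; rewrite -lerBrDl (le_trans le1).
Qed.

Definition nat_dist (k l : nat) := (k - l + (l - k))%N.

(** Bound on the interaction of a dipole with its copy [j] steps away, in units of
    [(h ^+ 2) `^ H]. *)
Definition self_weight H (j : nat) : R := if j is j'.+1 then H / j'.+1%:R else 1.

(** The copies on each side of the [k]-th one contribute a harmonic sum. *)
Lemma sum_self_weight H m (k : nat) : 0 < H < 1 -> (k < m)%N ->
  \sum_(0 <= l < m) self_weight H (nat_dist k l) <= 1 + 2 * m%:R `^ H.
Proof.
move=> H01 km; have /andP[H0 _] := H01.
have mono p : (p <= m)%N -> \sum_(0 <= i < p) self_weight H i.+1 <= m%:R `^ H.
  move=> pm; apply: le_trans (harmonic_powR p H01) _.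
  by apply: ge0_ler_powR; rewrite ?nnegrE ?ler0n ?ler_nat// ltW.
rewrite (@big_cat_nat _ _ _ k)//=; last exact: ltnW.
have -> : \sum_(0 <= l < k) self_weight H (nat_dist k l) =
    \sum_(0 <= i < k) self_weight H i.+1.
  rewrite big_nat_rev /= add0n; apply: eq_big_nat => i /andP[_ ik].
  have -> : nat_dist k (k - i.+1) = i.+1; last by [].
  by rewrite /nat_dist subKn// (eqP (leq_subr _ _)) addn0.
have -> : \sum_(k <= l < m) self_weight H (nat_dist k l) =
    \sum_(0 <= i < m - k) self_weight H i.
  rewrite -{1}[k]add0n big_addn; apply: eq_bigr => i _.
  by rewrite /nat_dist addnK (eqP (leq_addl _ _)) add0n.
have := mono k (ltnW km).
have -> : (m - k = (m - k).-1.+1)%N by rewrite prednK// subn_gt0.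
rewrite big_nat_recl//= => h1.
have := mono (m - k).-1 (leq_trans (leq_pred _) (leq_subr _ _)).
lra.
Qed.

(** A quarter of the energy of the four charges of a circle at height 0 against
    those at height [r]: attraction of opposite dipoles minus interaction of a
    dipole with its own copy. *)
Definition dipole_energy a h H r :=
  (a ^+ 2 + r ^+ 2) `^ H - ((a - h) ^+ 2 + r ^+ 2) `^ H -
  ((h ^+ 2 + r ^+ 2) `^ H - (r ^+ 2) `^ H).

(** The first bound keeps only one factor [h], which reflects the corner of the
    distance at the antipode. *)
Lemma dipole_energy_lower a h H r e j : 0 < H -> H <= 2^-1 -> 0 < h <= a ->
  0 <= r <= e -> (if j is 0%N then r = 0 else j%:R * h <= r) ->
  h * (H * a * ((a ^+ 2) `^ H / (a ^+ 2 + e ^+ 2))) - (h ^+ 2) `^ H * self_weight H j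
    <= dipole_energy a h H r.
Proof.
move=> H0 H12 /andP[h0 ha] /andP[r0 re] hj.
have H01 : 0 < H < 1 by apply/andP; split; lra.
have a0 : 0 < a by lra.
have self : (h ^+ 2 + r ^+ 2) `^ H - (r ^+ 2) `^ H <= (h ^+ 2) `^ H * self_weight H j.
  case: j hj => [->|j hj].
    by rewrite expr0n/= addr0 powR0 ?gt_eqF// subr0 mulr1.
  by apply: powR_sub_upper => //; rewrite ler1n.
have cross : h * (H * a * ((a ^+ 2) `^ H / (a ^+ 2 + e ^+ 2))) <=
    (a ^+ 2 + r ^+ 2) `^ H - ((a - h) ^+ 2 + r ^+ 2) `^ H.
  set A := a ^+ 2 + r ^+ 2; set B := (a - h) ^+ 2 + r ^+ 2.
  have a20 : 0 < a ^+ 2 by exact: exprn_gt0.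
  have r20 : 0 <= r ^+ 2 by exact: sqr_ge0.
  have A0 : 0 < A by rewrite /A; lra.
  have B0 : 0 <= B by rewrite addr_ge0 ?sqr_ge0.
  apply: le_trans (powR_sub_lower A0 B0 H01).
  have AB : h * a <= A - B by rewrite /A /B; nra.
  have re2 : r ^+ 2 <= e ^+ 2 by rewrite ler_pXn2r ?nnegrE//; lra.
  have -> : h * (H * a * ((a ^+ 2) `^ H / (a ^+ 2 + e ^+ 2))) =
     H * (h * a) * ((a ^+ 2) `^ H / (a ^+ 2 + e ^+ 2)) by ring.
  apply: ler_pM.
  - by rewrite !mulr_ge0// ltW.
  - by rewrite divr_ge0 ?powR_ge0// addr_ge0// sqr_ge0.
  - by rewrite ler_pM2l.
  - apply: ler_pM; rewrite ?powR_ge0 ?invr_ge0 ?addr_ge0 ?sqr_ge0//.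
      apply: ge0_ler_powR; rewrite ?nnegrE ?(ltW H0) ?(ltW a20) ?(ltW A0)//.
      by rewrite /A; lra.
    by rewrite lef_pV2 ?posrE// /A; lra.
rewrite /dipole_energy; lra.
Qed.

(** For 2 H > 1 a single copy is enough.  Otherwise take [m] copies and h = e / m:
    the antipodal terms add up to m ^ 2 c h = m c e, and the self-interactions to
    at most (h ^ 2) ^ H m (1 + 2 m ^ H) <= 3 E m ^ (1 - H) with E = (e ^ 2) ^ H, so
    it suffices that m ^ H > B = 3 E / (c e). *)
Lemma positive_total_energy H a e : 0 < H -> 0 < a -> 0 < e ->
  exists (m : nat) (h : R), [/\ (0 < m)%N, 0 < h <= a, m%:R * h <= e &
    forall rho : nat -> nat -> R, (forall k, rho k k = 0) ->
      (forall k l, (k < m)%N -> (l < m)%N ->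
         (nat_dist k l)%:R * h <= rho k l <= 2 * e) ->
      0 < \sum_(k < m) \sum_(l < m) dipole_energy a h H (rho k l)].
Proof.
move=> H0 a0 e0; have [H12|H12] := ltP 2^-1 H.
  exists 1%N, (Num.min e (a / 2)); set h := Num.min _ _.
  have h0 : 0 < h by rewrite lt_min e0 divr_gt0.
  have ha : h <= a / 2 by rewrite ge_min lexx orbT.
  split=> //; first by apply/andP; split=> //; lra.
    by rewrite mul1r ge_min lexx.
  move=> rho rho0 _; rewrite !big_ord1 rho0 /dipole_energy expr0n/= !addr0.
  rewrite powR0 ?gt_eqF// subr0 !sqr_powR ?(ltW a0) ?(ltW h0)//; last lra.
  have ah : 0 < a - h by lra.
  have p1 : 1 < 2 * H by lra.
  have := powR_superadditive ah h0 p1; rewrite subrK; lra.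
have H01 : 0 < H < 1 by apply/andP; split; lra.
pose c := H * a * ((a ^+ 2) `^ H / (a ^+ 2 + (2 * e) ^+ 2)).
have c0 : 0 < c.
  rewrite !mulr_gt0// ?powR_gt0 ?exprn_gt0// invr_gt0 addr_gt0 ?exprn_gt0//.
  by rewrite mulr_gt0.
pose E := (e ^+ 2) `^ H.
have E0 : 0 < E by rewrite powR_gt0// exprn_gt0.
pose B := 3 * E / (c * e).
have B0 : 0 < B by apply: divr_gt0; apply: mulr_gt0.
pose X := B `^ H^-1 + e / a + 1.
have X1 : 1 <= X by rewrite /X lerDr addr_ge0 ?powR_ge0// divr_ge0// ltW.
pose m := Num.bound X.
have mX : X < m%:R by apply: archi_boundP; lra.
have m1 : 1 < m%:R :> R by lra.
have m0 : 0 < m%:R :> R by lra.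
have mB : B < m%:R `^ H.
  have -> : B = (B `^ H^-1) `^ H by rewrite -powRrM mulVf ?gt_eqF// powRr1// ltW.
  apply: gt0_ltr_powR; rewrite ?nnegrE ?powR_ge0 ?(ltW m0)//.
  apply: le_lt_trans mX; rewrite /X.
  have : 0 <= e / a by rewrite divr_ge0// ltW.
  lra.
pose h := e / m%:R.
have h0 : 0 < h by exact: divr_gt0.
have ha : h <= a.
  rewrite ler_pdivrMr// -ler_pdivrMl// mulrC; apply: le_trans (ltW mX).
  rewrite /X; have := powR_ge0 B H^-1; lra.
exists m, h; split; [by rewrite -(ltr_nat R)|by rewrite h0|by rewrite /h mulrC divfK ?gt_eqF|].
move=> rho rho0 hrho.
pose w (k l : nat) : R := h * c - (h ^+ 2) `^ H * self_weight H (nat_dist k l).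
have lower : \sum_(k < m) \sum_(l < m) w k l <=
    \sum_(k < m) \sum_(l < m) dipole_energy a h H (rho k l).
  apply: ler_sum => k _; apply: ler_sum => l _.
  have /andP[r1 r2] := hrho k l (ltn_ord k) (ltn_ord l).
  apply: dipole_energy_lower => //; first by rewrite h0.
    by rewrite r2 (le_trans _ r1)// mulr_ge0// ltW.
  case E' : (nat_dist k l) => [|j]; last by rewrite -E'.
  have -> : (k : nat) = l by move/eqP: E'; rewrite /nat_dist addn_eq0 !subn_eq0 -eqn_leq => /eqP.
  exact: rho0.
apply: lt_le_trans lower.
have h2 : (h ^+ 2) `^ H = E / (m%:R `^ H) ^+ 2.
  have -> : (m%:R `^ H) ^+ 2 = (m%:R ^+ 2) `^ H by rewrite !expr2 powRM// ltW.
  have m2 : 0 < (m%:R ^+ 2) `^ H by rewrite powR_gt0// exprn_gt0.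
  apply: (canRL (mulfK (lt0r_neq0 m2))); rewrite -powRM ?sqr_ge0// -exprMn.
  by rewrite /h divfK// gt_eqF.
set mu := m%:R `^ H in mB h2.
have mu1 : 1 <= mu by apply: powR_ge1; exact: ltW.
have row (k : 'I_m) : h * c * m%:R - (h ^+ 2) `^ H * (1 + 2 * mu) <= \sum_(l < m) w k l.
  have -> : \sum_(l < m) w k l =
      h * c * m%:R - (h ^+ 2) `^ H * \sum_(l < m) self_weight H (nat_dist k l).
    by rewrite /w sumrB sumr_const card_ord -(mulr_natr (h * c)) mulr_sumr.
  rewrite lerD2l lerN2 ler_wpM2l ?powR_ge0//.
  by have := sum_self_weight H01 (ltn_ord k); rewrite big_mkord.
have total : (h * c * m%:R - (h ^+ 2) `^ H * (1 + 2 * mu)) * m%:R <=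
    \sum_(k < m) \sum_(l < m) w k l.
  rewrite -[X in _ * X%:R]card_ord mulr_natr -sumr_const; exact: ler_sum.
apply: lt_le_trans total; rewrite pmulr_lgt0// subr_gt0 h2.
have -> : h * c * m%:R = c * e by rewrite /h; field; rewrite gt_eqF.
have mu0 : 0 < mu by lra.
apply: (@le_lt_trans _ _ (3 * E / mu)).
  have -> : 3 * E / mu = E / mu ^+ 2 * (3 * mu) by field; rewrite gt_eqF.
  by rewrite ler_wpM2l ?divr_ge0 ?sqr_ge0 ?(ltW E0)//; lra.
have ce0 : 0 < c * e by exact: mulr_gt0.
by rewrite ltr_pdivrMr// [ltRHS]mulrC -ltr_pdivrMr.
Qed.

End Powers.

(** * Failure of negative definiteness on the product *)

Section NegativeDefinite.
Context {R : realType}.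

Lemma negative_definite_fin (S : Type) (f : S -> S -> R) (I : finType)
    (x : I -> S) (c : I -> R) : negative_definite_kernel f ->
  \sum_i c i = 0 -> \sum_i \sum_j c i * c j * f (x i) (x j) <= 0.
Proof.
move=> [_ ndk] c0.
have E (F : I -> R) : \sum_(i < #|I|) F (enum_val i) = \sum_i F i.
  by rewrite [RHS](reindex (@enum_val I I))//; exact: onW_bij (enum_val_bij I).
have := ndk #|I| (x \o enum_val) (c \o enum_val).
rewrite E => /(_ c0); rewrite -E; apply: le_trans.
by rewrite le_eqVlt; apply/orP; left; apply/eqP/eq_bigr => i _; rewrite -E.
Qed.

Lemma sum_bool2 (F : bool * bool -> R) : \sum_t F t =
  (F (true, true) + F (true, false)) + (F (false, true) + F (false, false)).
Proof.
rewrite (eq_bigr (fun t => F (t.1, t.2))) => [|[]//].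
by rewrite -(pair_bigA _ (fun t1 t2 => F (t1, t2))) /= !big_bool.
Qed.

End NegativeDefinite.

Section Cylinder.
Context {R : realType} {m n : nat}.
Variables (M : riemannian_manifold R m) (N : riemannian_manifold R n).
Local Notation dM := (geodesic_dist M).
Local Notation dN := (geodesic_dist N).
Local Notation dP := (geodesic_dist (riemannian_prod M N)).

(** A chart is open, and its image in a space of positive dimension contains a
    second point near the first. *)
Lemma distinct_points : (0 < n)%N -> exists P Q : N, P <> Q.
Proof.
move=> n0; have [P _] := manifold_nonempty N.
pose phi := charts (chart_at P); have iP := chart_atP P.
have cx : chart_cod phi (phi P) by exact: chart_mapP.
have : \forall y \near phi P, chart_cod phi y.
  by apply: open_nbhs_nbhs; split=> //; exact: chart_cod_open.
move=> /nbhs_ballP[d /= d0 hd].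
pose y := phi P + const_mx (d / 2).
have cy : chart_cod phi y.
  apply: hd; split=> // i j; rewrite -ball_normE /= !mxE opprD addNKr normrN.
  by rewrite gtr0_norm ?divr_gt0//; lra.
exists P, (chart_inv phi y) => E.
have := chart_invK cy; rewrite -E => /matrixP/(_ 0 (Ordinal n0)).
rewrite !mxE => /eqP; rewrite -subr_eq0 opprD addNKr oppr_eq0 => /eqP.
lra.
Qed.

(** [S r] is a point at distance [r] from a fixed point, found on a curve that
    leaves it; the bounds are then triangle inequalities. *)
Lemma separated_points : (0 < n)%N -> exists2 e : R, 0 < e & exists S : R -> N,
  forall r r', 0 <= r <= e -> 0 <= r' <= e ->
    `|r - r'| <= dN (S r) (S r') <= 2 * e.
Proof.
move=> /distinct_points[P [Q PQ]].
have e0 : 0 < dN P Q.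
  by rewrite lt_neqAle geodesic_dist_ge0 andbT eq_sym; apply/eqP => /geodesic_dist_eq0.
exists (dN P Q) => //.
have [g [a [b [pC ga gb _]]]] := geodesic_dist_near_minimal P Q ltr01.
have ab := ltW (piecewise_C1_lt pC).
have /choice[S hS] : forall r : R, exists T, 0 <= r <= dN P Q -> dN P T = r.
  move=> r; have [/andP[r0 re]|] := pselect (0 <= r <= dN P Q); last by exists P.
  have [|t _ <-] := dist_on_curve_IVT (v := r) (P := P) pC (lexx a) ab (lexx b).
    by rewrite ga gb geodesic_distxx ge_min le_max r0 re orbT.
  by exists (g t).
exists S => r r' hr hr'; have Sr := hS _ hr; have Sr' := hS _ hr'.
move: hr hr' => /andP[r0 re] /andP[r0' re'].
apply/andP; split; first by rewrite -{1}Sr -{1}Sr' geodesic_dist_lipschitz.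
have := geodesic_dist_triangle P (S r) (S r').
rewrite (geodesic_dist_sym (S r) P) Sr Sr'; lra.
Qed.

(** The charges are indexed by a pair of booleans (which end of the diameter, which
    point of the dipole) and the copy. *)
Lemma cylinder_not_negative_definite (P Q : M) (e H : R) (S : R -> N) :
  0 < H -> 0 < dM P Q ->
  (forall h, 0 <= h <= dM P Q -> exists X Y,
    [/\ dM P X = h, dM Q Y = h, dM P Y = dM P Q - h, dM X Q = dM P Q - h &
       dM X Y = dM P Q]) ->
  0 < e -> (forall r r', 0 <= r <= e -> 0 <= r' <= e ->
    `|r - r'| <= dN (S r) (S r') <= 2 * e) ->
  ~ negative_definite_kernel (fun p q : riemannian_prod M N => dP p q `^ (2 * H)).
Proof.
move=> H0 a0 antip e0 hS ndk.
set a := dM P Q in a0 antip.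
have [k [h [k0 /andP[h0 ha] khe pos]]] := positive_total_energy H0 a0 e0.
have [|X [Y [PX QY PY XQ XY]]] := antip h; first by rewrite (ltW h0).
pose T i := S (i%:R * h).
pose rho (i j : nat) := dN (T i) (T j).
have {}pos : 0 < \sum_(i < k) \sum_(j < k) dipole_energy a h H (rho i j).
  apply: pos => [i|i j ik jk]; first exact: geodesic_distxx.
  have inn p : (p < k)%N -> 0 <= p%:R * h <= e.
    move=> pk; rewrite mulr_ge0 ?(ltW h0)//=; apply: le_trans khe.
    by rewrite ler_pM2r// ler_nat ltnW.
  have := hS _ _ (inn i ik) (inn j jk); rewrite -/(rho i j).
  rewrite -mulrBl normrM (gtr0_norm h0).
  suff -> : `|i%:R - j%:R| = (nat_dist i j)%:R :> R by [].
  rewrite /nat_dist natrD; have [ij|/ltnW ji] := leqP i j.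
    have -> : (i - j = 0)%N by apply/eqP; rewrite subn_eq0.
    by rewrite add0r natrB// distrC ger0_norm// subr_ge0 ler_nat.
  have -> : (j - i = 0)%N by apply/eqP; rewrite subn_eq0.
  by rewrite addr0 natrB// ger0_norm// subr_ge0 ler_nat.
pose pt (t : bool * bool) : M :=
  if t.1 then (if t.2 then Y else Q) else (if t.2 then X else P).
pose sg (t : bool * bool) : R := if t.2 then -1 else 1.
pose x (w : (bool * bool) * 'I_k) : riemannian_prod M N := (pt w.1, T w.2).
have c0 : \sum_(w : (bool * bool) * 'I_k) sg w.1 = 0.
  rewrite -(pair_bigA _ (fun t (i : 'I_k) => sg t)) /=.
  by rewrite sum_bool2 /sg /= !sumr_const !mulNrn !addNr addr0.
have := negative_definite_fin x ndk c0.
suff -> : \sum_i \sum_j sg i.1 * sg j.1 * dP (x i) (x j) `^ (2 * H) =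
    4 * \sum_(i < k) \sum_(j < k) dipole_energy a h H (rho i j).
  by rewrite leNgt mulr_gt0.
pose G (t t' : bool * bool) (i j : 'I_k) : R :=
  sg t * sg t' * ((dM (pt t) (pt t')) ^+ 2 + (rho i j) ^+ 2) `^ H.
have GE w w' : sg w.1 * sg w'.1 * dP (x w) (x w') `^ (2 * H) = G w.1 w'.1 w.2 w'.2.
  by rewrite product_dist sqrt_powR// addr_ge0 ?sqr_ge0.
under eq_bigr do under eq_bigr do rewrite GE.
rewrite -(pair_bigA _ (fun t i => \sum_(w' : (bool * bool) * 'I_k) G t w'.1 i w'.2)) /=.
under eq_bigr => t _ do under eq_bigr => i _ do
  rewrite -(pair_bigA _ (fun t' j => G t t' i j)) /=.
rewrite exchange_big /= mulr_sumr; apply: eq_bigr => i _.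
under eq_bigr do rewrite exchange_big /=.
rewrite exchange_big /= mulr_sumr; apply: eq_bigr => j _.
rewrite !sum_bool2 /G /sg /pt /= !geodesic_distxx.
rewrite (geodesic_dist_sym Y Q) (geodesic_dist_sym Y X) (geodesic_dist_sym Y P).
rewrite (geodesic_dist_sym Q X) (geodesic_dist_sym Q P) (geodesic_dist_sym X P).
rewrite PX QY PY XQ XY -/a /dipole_energy expr0n/= add0r; ring.
Qed.

End Cylinder.

Theorem theorem2 (R : realType) (m n : nat)
    (M : riemannian_manifold R m) (N : riemannian_manifold R n)
    (n_gt0 : (0 < n)%N)
    (M_closed : exists (gamma : R -> M) (a b : R),
      minimal_closed_geodesic M gamma a b) :
  is_fractional_index (geodesic_dist (riemannian_prod M N)) 0%E.
Proof.
have [gamma [a [b mcg]]] := M_closed.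
have [P [Q [a0 antip]]] := closed_geodesic_antipodes mcg.
have [e e0 [S hS]] := separated_points N n_gt0.
split=> [//|H H0]; split=> [ndk|].
  by have := cylinder_not_negative_definite H0 a0 antip e0 hS ndk.
by rewrite lee_fin => le0; have : 0 < 2 * H by [rewrite mulr_gt0]; rewrite ltNge le0.
Qed.
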